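(* Let $d\ge2$, let $M^1$ be $S^1$ or $[0,2\pi]$, and let $k(x,u,y,v)=\rho(|x-y|^2)\,\gamma(u\cdot v)$ be a kernel on $\mathbb{R}^d\times S^{d-1}$ as described in the context, with associated varifold pseudo-distance $d^{\mathrm{Var}}$. Assume that $\rho$ and $\gamma$ are $C^1$-functions, that $\rho$ is $C_0$-universal, that $\gamma(1)>0$, and that $\gamma$ is an even function. Then two immersed curves $c_1,c_2\in\mathrm{Imm}(M^1,\mathbb{R}^d)$ with finite numbers of transverse self-intersections are equal in $B_i(M^1,\mathbb{R}^d)=\mathrm{Imm}(M^1,\mathbb{R}^d)/\mathrm{Diff}(M^1)$ if and only if $d^{\mathrm{Var}}(c_1,c_2)=0$.
   Context: $S^1=\mathbb{R}/2\pi\mathbb{Z}$. $\mathrm{Imm}(M^1,\mathbb{R}^d)=\{c\in C^\infty(M^1,\mathbb{R}^d): c'(\theta)\ne0\ \forall\theta\in M^1\}$. $\mathrm{Diff}(M^1)$ is the group of smooth diffeomorphisms of $M^1$ (orientation-reversing ones included), acting on immersions by $c\mapsto c\circ\varphi$; two immersions are equal in $B_i(M^1,\mathbb{R}^d)$ iff $c_2=c_1\circ\varphi$ for some $\varphi\in\mathrm{Diff}(M^1)$. An immersion with a finite number of transverse self-intersections is one whose self-intersections (points of $\mathbb{R}^d$ having more than one preimage) are finite in number and such that at each self-intersection point the tangent vectors $c'(\theta)$ at distinct preimages $\theta$ are pairwise non-collinear. Kernel and metric: $C_0(X)$ denotes continuous functions on $X$ vanishing at infinity. The function $\rho$ defines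 a continuous, positive radial basis function (i.e. $(x,y)\mapsto\rho(|x-y|^2)$ is a positive definite kernel on $\mathbb{R}^d$) with $\rho(t)\to0$ as $t\to\infty$, and $\gamma:[-1,1]\to\mathbb{R}$ defines a continuous positive definite zonal kernel $(u,v)\mapsto\gamma(u\cdot v)$ on $S^{d-1}$. The kernel $k$ on $\mathbb{R}^d\times S^{d-1}$ is positive definite and generates a reproducing kernel Hilbert space $\mathcal{H}$ continuously embedded in $C_0(\mathbb{R}^d\times S^{d-1})$. The kernel $\rho$ is $C_0$-universal if the reproducing kernel Hilbert space of $(x,y)\mapsto\rho(|x-y|^2)$ is dense in $C_0(\mathbb{R}^d,\mathbb{R})$. For $c\in\mathrm{Imm}(M^1,\mathbb{R}^d)$ let $\mu_c\in C_0(\mathbb{R}^d\times S^{d-1})^*$ be the oriented varifold $\mu_c(\omega)=\int_{M^1}\omega\big(c(\theta),\tfrac{c'(\theta)}{|c'(\theta)|}\big)|c'(\theta)|\,\mathrm{d}\theta$, viewed in $\mathcal{H}^*$ by restriction. Let $\langle\cdot,\cdot\rangle_{\mathrm{Var}}$ be the dual inner product on $\mathcal{H}^*$ with norm $\|\cdot\|_{\mathrm{Var}}$. Then $d^{\mathrm{Var}}(c_1,c_2)=\|\mu_{c_1}-\mu_{c_2}\|_{\mathrm{Var}}$, where explicitly $$\langle\mu_{c_1},\mu_{c_2}\rangle_{\mathrm{Var}}=\iint_{M^1\times M^1}\rho(|c_1(\theta_1)-c_2(\theta_2)|^2)\,\gamma\!\left(\tfrac{c_1'(\theta_1)}{|c_1'(\theta_1)|}\cdot\tfrac{c_2'(\theta_2)}{|c_2'(\theta_2)|}\right)|c_1'(\theta_1)|\,|c_2'(\theta_2)|\,\mathrm{d}\theta_1\mathrm{d}\theta_2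 .$$ *)

(* Defs.v *)
From HB Require Import structures.
From mathcomp Require Import all_boot all_order all_algebra.
From mathcomp Require Import all_classical all_reals all_analysis.

Set Implicit Arguments.
Unset Strict Implicit.
Unset Printing Implicit Defensive.

Import Order.TTheory GRing.Theory Num.Theory.
Import numFieldNormedType.Exports.

Local Open Scope ring_scope.
Local Open Scope classical_set_scope.

(* The norm [`|x|] of the library on ['rV[R]_d] is the sup norm; it is only
   used through its topology. *)
Definition dotv (R : realType) (d : nat) (u v : 'rV[R]_d) : R :=
  \sum_(i < d) u 0 i * v 0 i.

Definition enorm (R : realType) (d : nat) (u : 'rV[R]_d) : R :=
  Num.sqrt (dotv u u).

Definition sphere (R : realType) (d : nat) : set 'rV[R]_d :=
  [set u | enorm u = 1].
Arguments sphere : clear implicits.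

Definition pos_dir (R : realType) (d : nat) : topologicalType :=
  ('rV[R]_d * sphere R d)%type.

Definition C0 (R : realType) (X : topologicalType) : set (X -> R) :=
  [set f | continuous f /\
    forall e : R, 0 < e ->
      exists2 K : set X, compact K & forall x, ~ K x -> `|f x| < e].

(* Functions whose natural domain [A] is a proper subset of R (rho on
   [0, +oo[, gamma on [-1, 1]) are represented by total functions; their
   values outside [A] play no role.  C^1 on [A] means that [f] coincides on
   [A] with a C^1 function defined on an open neighbourhood of [A]. *)
Definition C1_on (R : realType) (A : set R) (f : R -> R) : Prop :=
  exists (U : set R) (g : R -> R),
    [/\ open U, A `<=` U, forall x, A x -> f x = g x
      & forall x, U x -> derivable g x 1 /\ {for x, continuous g^`()}].

(* A smooth function on [A] is represented by a total function that is smooth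
   on an open neighbourhood of [A], so that its derivatives at the boundary
   points of [A] are the one-sided derivatives of its restriction to [A]. *)
Definition smooth_on (R : realType) (V : normedModType R) (A : set R)
    (f : R -> V) : Prop :=
  exists U : set R, [/\ open U, A `<=` U
    & forall (n : nat) (x : R), U x -> derivable f^`(n) x 1].

Definition positive_definite (R : realType) (X : Type) (K : X -> X -> R) :
    Prop :=
  (forall x y, K x y = K y x) /\
  forall (n : nat) (x : 'I_n -> X) (a : 'I_n -> R),
    0 <= \sum_(i < n) \sum_(j < n) a i * a j * K (x i) (x j).

Definition form_norm (R : realType) (E : Type) (B : E -> E -> R) (f : E) : R :=
  Num.sqrt (B f f).

Record rkhs (R : realType) (X : Type) (K : X -> X -> R) := Rkhs {
  rkhs_set : set (X -> R);
  rkhs_dot : (X -> R) -> (X -> R) -> R;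
  rkhs0 : rkhs_set (fun=> 0);
  rkhs_linear : forall (a : R) (f g : X -> R), rkhs_set f -> rkhs_set g ->
    rkhs_set (fun x => a * f x + g x);
  rkhs_dotC : forall f g, rkhs_set f -> rkhs_set g ->
    rkhs_dot f g = rkhs_dot g f;
  rkhs_dot_linear : forall (a : R) (f g h : X -> R),
    rkhs_set f -> rkhs_set g -> rkhs_set h ->
    rkhs_dot (fun x => a * f x + g x) h = a * rkhs_dot f h + rkhs_dot g h;
  rkhs_dot_ge0 : forall f, rkhs_set f -> 0 <= rkhs_dot f f;
  rkhs_dot_eq0 : forall f, rkhs_set f -> rkhs_dot f f = 0 -> f = (fun=> 0);
  rkhs_complete : forall u : nat -> X -> R, (forall n, rkhs_set (u n)) ->
    (forall e : R, 0 < e -> exists N : nat, forall m n : nat,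
      (N <= m)%N -> (N <= n)%N -> form_norm rkhs_dot (u m \- u n) < e) ->
    exists2 f : X -> R, rkhs_set f
      & form_norm rkhs_dot (u n \- f) @[n --> \oo] --> 0;
  rkhs_kernel : forall x, rkhs_set (K x);
  rkhs_reproducing : forall f x, rkhs_set f -> rkhs_dot f (K x) = f x
}.

Definition rkhs_norm (R : realType) (X : Type) (K : X -> X -> R) (H : rkhs K) :
    (X -> R) -> R :=
  form_norm (rkhs_dot H).

Definition embedded_C0 (R : realType) (X : topologicalType) (K : X -> X -> R)
    (H : rkhs K) : Prop :=
  rkhs_set H `<=` C0 (R := R) (X := X) /\
  exists C : R, forall f x, rkhs_set H f -> `|f x| <= C * rkhs_norm H f.

Definition C0_universal (R : realType) (X : topologicalType)
    (K : X -> X -> R) : Prop :=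
  exists H : rkhs K, rkhs_set H `<=` C0 (R := R) (X := X) /\
    forall f : X -> R, C0 f -> forall e : R, 0 < e ->
      exists2 h : X -> R, rkhs_set H h & forall x, `|f x - h x| <= e.

(* The norm of a linear form on H.  When the form is bounded on H, the set below
   is nonempty and bounded above, so [sup] is a genuine supremum; it is the norm
   of the inner product that the Riesz isomorphism transports from H to its
   dual. *)
Definition dual_norm (R : realType) (X : Type) (K : X -> X -> R) (H : rkhs K)
    (l : (X -> R) -> R) : R :=
  sup [set `|l f| | f in [set f : X -> R | rkhs_set H f /\ rkhs_norm H f <= 1]].

Definition radial_kernel (R : realType) (d : nat) (rho : R -> R)
    (x y : 'rV[R]_d) : R :=
  rho (enorm (x - y) ^+ 2).

Definition zonal_kernel (R : realType) (d : nat) (gamma : R -> R)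
    (u v : sphere R d) : R :=
  gamma (dotv (set_val u) (set_val v)).

Definition varifold_kernel (R : realType) (d : nat) (rho gamma : R -> R)
    (p q : pos_dir R d) : R :=
  radial_kernel rho p.1 q.1 * zonal_kernel gamma p.2 q.2.

Inductive manifold1 := Circle | Segment.

(* Functions on [M] are functions on R of which only the restriction to
   [dom M] matters and which respect [same M]: 2 pi-periodic functions on R for
   the circle R / 2 pi Z, functions on [0, 2 pi] for the segment. *)
Definition dom (R : realType) (M : manifold1) : set R :=
  match M with Circle => [set: R] | Segment => `[0, 2 * pi] end.

Definition same (R : realType) (M : manifold1) (s t : R) : Prop :=
  match M with
  | Circle => exists k : int, t = s + k%:~R * (2 * pi)
  | Segment => s = t
  end.

Definition immersion (R : realType) (d : nat) (M : manifold1)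
    (c : R -> 'rV[R]_d) : Prop :=
  [/\ smooth_on (dom M) c,
      forall s t, dom M s -> dom M t -> same M s t -> c s = c t
    & forall t, dom M t -> c^`() t != 0].

(* For the circle, [phi] is a lift to R of the map R / 2 pi Z -> R / 2 pi Z. *)
Definition smooth_self_map (R : realType) (M : manifold1) (phi : R -> R) :
    Prop :=
  [/\ smooth_on (dom M) phi,
      forall t, dom M t -> dom M (phi t)
    & forall s t, dom M s -> dom M t -> same M s t -> same M (phi s) (phi t)].

Definition diffeo (R : realType) (M : manifold1) (phi : R -> R) : Prop :=
  smooth_self_map M phi /\
  exists psi : R -> R, [/\ smooth_self_map M psi,
    forall t, dom M t -> same M (psi (phi t)) t
    & forall t, dom M t -> same M (phi (psi t)) t].

Definition equal_in_Bi (R : realType) (d : nat) (M : manifold1)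
    (c1 c2 : R -> 'rV[R]_d) : Prop :=
  exists2 phi : R -> R, diffeo M phi
    & forall t, dom M t -> c2 t = c1 (phi t).

Definition self_intersections (R : realType) (d : nat) (M : manifold1)
    (c : R -> 'rV[R]_d) : set 'rV[R]_d :=
  [set p | exists s t : R,
    [/\ dom M s, dom M t, ~ same M s t, c s = p & c t = p]].

Definition collinear (R : realType) (d : nat) (u v : 'rV[R]_d) : Prop :=
  exists a b : R, ((a != 0) || (b != 0)) /\ a *: u + b *: v = 0.

Definition finite_transverse_self_intersections (R : realType) (d : nat)
    (M : manifold1) (c : R -> 'rV[R]_d) : Prop :=
  finite_set (self_intersections M c) /\
  forall s t, dom M s -> dom M t -> ~ same M s t -> c s = c t ->
    ~ collinear (c^`()%classic s) (c^`()%classic t).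

(* [omega (x, u)] for a vector [u] of ['rV[R]_d], extended by 0 off the sphere. *)
Definition eval_dir (R : realType) (d : nat) (omega : pos_dir R d -> R)
    (x u : 'rV[R]_d) : R :=
  oapp (fun v : sphere R d => omega (x, v)) 0 (insub u).

(* In both cases the integral over [M] is the integral over [0, 2 pi]. *)
Definition varifold (R : realType) (d : nat) (c : R -> 'rV[R]_d)
    (omega : pos_dir R d -> R) : R :=
  (\int[lebesgue_measure]_(t in `[0%R, 2 * pi])
    (eval_dir omega (c t) ((enorm (c^`()%classic t))^-1 *: c^`()%classic t)
     * enorm (c^`()%classic t)))%R.

Definition dVar (R : realType) (d : nat) (rho gamma : R -> R)
    (H : rkhs (@varifold_kernel R d rho gamma)) (c1 c2 : R -> 'rV[R]_d) : R :=
  dual_norm H (fun omega => varifold c1 omega - varifold c2 omega).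

(* Main.v *)
Require Import Defs.
From HB Require Import structures.
From mathcomp Require Import all_boot all_order all_algebra.
From mathcomp Require Import all_classical all_reals all_analysis.
From mathcomp Require Import ring lra zify.

(** The key is that a varifold determines the image of its curve, and that for
curves with finitely many transverse self-intersections the image determines the
parametrised curve up to a diffeomorphism.

If the distance vanishes, the two varifolds agree on all functions
[x, u |-> h x * gamma (v . u)] with [h] in the Hilbert space of [rho]: for fixed
[v] their difference is a bounded functional of [h] that kills the kernel
functions ([rkhs_functional_eq0]). By universality they agree for every [h] that
is continuous and vanishes at infinity ([varifold_tensor_eq]). Let [p] be a
simple point of the first curve and [v] its unit tangent there. Near [p] the
factor [gamma (v . u)] is positive along the first curve, since
[gamma 1 > 0]; so a bump function [h] at [p] has positive integral along the first
curve, and along the second one too, which thus passes through [p]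
([simple_point_in_image]). Simple points are dense in a curve with finitely many
self-intersections, and images are compact, so the images coincide
([image_subset]).

Given equal images, call parameters [t] of [c2] and [s] of [c1] coincident
if the curves have there the same position and the same tangent line
([tangent_at]). Every [t] has a coincident [s]: a limit of parameters [s_n] with
[c1 s_n = c2 t_n], [t_n -> t], works, since the secants converge to the tangents
([exists_tangent]). It is unique by transversality ([tangent_at_unique]). Solving
one coordinate of [c1 s = c2 t] by the inverse function theorem shows that [s] is
locally a smooth function of [t] ([tangent_graph]). On the circle the local
solutions are glued along the line by integrating their common slope
([circle_section]). The relation being symmetric, the same construction with the
curves exchanged gives the inverse map ([equal_images_equal_in_Bi]).

Conversely, evenness of [gamma] makes all functions of the Hilbert space even in
the direction ([rkhs_even]), and the integral of such a function along a curve is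
invariant under reparametrisations of both orientations ([varifold_reparam]). *)

Set Implicit Arguments.
Unset Strict Implicit.
Unset Printing Implicit Defensive.

Import Order.TTheory GRing.Theory Num.Theory.
Import numFieldNormedType.Exports.

Local Open Scope ring_scope.
Local Open Scope classical_set_scope.

(** * Smooth functions of one real variable *)

Section Smooth.
Variable R : realType.
Implicit Types (f g : R -> R) (U V : set R).

Definition smooth_in (V : normedModType R) (U : set R) (f : R -> V) : Prop :=
  forall (n : nat) (x : R), U x -> derivable f^`(n) x 1.

Definition smooth_at (V : normedModType R) (f : R -> V) (x : R) : Prop :=
  exists U : set R, [/\ open U, U x & smooth_in U f].

(** Finite orders of smoothness, peeling off derivatives at the innermost
function: closure under products, compositions and inverses then follows by
induction, which it does not for [smooth_in] directly. *)
Fixpoint Ck (k : nat) (U : set R) (f : R -> R) : Prop :=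
  if k is k'.+1 then (forall x, U x -> derivable f x 1) /\ Ck k' U f^`()
  else True.

Lemma open_near (T : topologicalType) (U : set T) (P : T -> Prop) (x : T) :
  open U -> U x -> (forall y, U y -> P y) -> \forall y \near x, P y.
Proof.
move=> oU Ux UP; apply: filterS UP _; exact: open_nbhs_nbhs.
Qed.

Lemma near_open (T : topologicalType) (P : T -> Prop) (x : T) :
  (\forall y \near x, P y) ->
  exists U : set T, [/\ open U, U x & forall y, U y -> P y].
Proof.
move=> Px; have : nbhs x [set y | P y] by [].
by rewrite nbhsE => -[U [oU Ux] UP]; exists U.
Qed.

Lemma derivable_open_eq (V : normedModType R) U (f g : R -> V) x : open U ->
  (forall y, U y -> f y = g y) -> U x ->
  (derivable f x 1 -> derivable g x 1) /\ f^`() x = g^`() x.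
Proof.
move=> oU fg Ux; have fgx : {near x, f =1 g} by apply: (open_near oU).
have n1 : (1 : R) != 0 by exact: oner_neq0.
split; first by apply: near_eq_derivable.
by rewrite !derive1E; apply: near_eq_derive.
Qed.

Lemma derive1n_open_eq (V : normedModType R) U (f g : R -> V) n : open U ->
  (forall y, U y -> f y = g y) -> forall x, U x -> f^`(n) x = g^`(n) x.
Proof.
move=> oU; elim: n f g => [//|n IH] f g fg x Ux.
rewrite !derive1Sn; apply: IH => // y Uy.
exact: (derivable_open_eq oU fg Uy).2.
Qed.

Lemma smooth_in_eq (V : normedModType R) U (f g : R -> V) : open U ->
  (forall y, U y -> f y = g y) -> smooth_in U f -> smooth_in U g.
Proof.
move=> oU fg sf n x Ux; apply: (derivable_open_eq oU _ Ux).1 (sf n x Ux).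
exact: derive1n_open_eq.
Qed.

Lemma smooth_in_sub (V : normedModType R) U W (f : R -> V) :
  W `<=` U -> smooth_in U f -> smooth_in W f.
Proof. by move=> WU sf n x /WU; apply: sf. Qed.

Lemma smooth_at_near_eq (V : normedModType R) (f g : R -> V) x :
  (\forall y \near x, f y = g y) -> smooth_at f x -> smooth_at g x.
Proof.
move=> /near_open[W [oW Wx fg]] [U [oU Ux sf]].
exists (U `&` W); split => //; first exact: openI.
apply: (@smooth_in_eq _ _ f); first exact: openI.
  by move=> y [_ /fg].
by apply: smooth_in_sub sf => y [].
Qed.

(** Being smooth near each point is an open condition, so it yields the
neighbourhood that [smooth_on] asks for. *)
Lemma smooth_on_at (V : normedModType R) A (f : R -> V) :
  (forall x, A x -> smooth_at f x) -> smooth_on A f.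
Proof.
move=> sf; exists [set x | smooth_at f x]; split => //.
  rewrite openE => x [U [oU Ux sU]] /=; rewrite /interior nbhsE.
  by exists U => // y Uy; exists U.
by move=> n x [U [_ Ux]]; apply.
Qed.

Lemma smooth_at_on (V : normedModType R) A (f : R -> V) :
  smooth_on A f -> forall x, A x -> smooth_at f x.
Proof. by move=> [U [oU AU sf]] x /AU Ux; exists U; split => // n y; apply: sf. Qed.

Lemma smooth_at_derive1 (V : normedModType R) (f : R -> V) x :
  smooth_at f x -> smooth_at f^`() x.
Proof.
move=> [U [oU Ux sf]]; exists U; split => // n y Uy.
by rewrite -derive1Sn; apply: sf.
Qed.

Lemma smooth_at_derivable (V : normedModType R) (f : R -> V) x :
  smooth_at f x -> derivable f x 1.
Proof. by move=> [U [oU Ux sf]]; exact: (sf 0%N). Qed.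

Lemma smooth_at_near (V : normedModType R) (f : R -> V) x :
  smooth_at f x -> \forall y \near x, smooth_at f y.
Proof. by move=> [U [oU Ux sf]]; apply: (open_near oU) => // y Uy; exists U. Qed.

Lemma derivable_continuous (V : normedModType R) (f : R -> V) x :
  derivable f x 1 -> {for x, continuous f}.
Proof. by move=> /derivable1_diffP /differentiable_continuous. Qed.

Lemma smooth_at_continuous (V : normedModType R) (f : R -> V) x :
  smooth_at f x -> {for x, continuous f}.
Proof. by move=> /smooth_at_derivable /derivable_continuous. Qed.

Lemma derive1P f (x a : R) : derivable f x 1 -> f^`() x = a -> is_derive x 1 f a.
Proof. by move=> df fa; apply: DeriveDef => //; rewrite -derive1E. Qed.

Lemma is_derive_derive1 f (x a : R) : is_derive x 1 f a -> f^`() x = a.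
Proof. by rewrite derive1E => -[]. Qed.

Lemma Ck_eq k U f g : open U -> (forall x, U x -> f x = g x) ->
  Ck k U f -> Ck k U g.
Proof.
move=> oU; elim: k f g => //= k IH f g fg [df Cf]; split.
  by move=> x Ux; apply: (derivable_open_eq oU fg Ux).1 (df x Ux).
by apply: IH Cf => x Ux; exact: (derivable_open_eq oU fg Ux).2.
Qed.

Lemma Ck_le k U f : Ck k.+1 U f -> Ck k U f.
Proof. by elim: k f => //= k IH f [df [df' Cf]]; split => //; apply: IH. Qed.

Lemma smooth_inP U f : smooth_in U f <-> forall k, Ck k U f.
Proof.
split.
  move=> sf k; elim: k f sf => //= k IH f sf; split; first exact: (sf 0%N).
  by apply: IH => n x Ux; rewrite -derive1Sn; apply: sf.
move=> Cf n; elim: n f Cf => [|n IH] f Cf x Ux; first exact: (Cf 1%N).1.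
by rewrite derive1Sn; apply: IH => // k; exact: (Cf k.+1).2.
Qed.

Lemma CkD k U f g : open U -> Ck k U f -> Ck k U g ->
  Ck k U (fun x => f x + g x).
Proof.
move=> oU; elim: k f g => //= k IH f g [df Cf] [dg Cg]; split.
  by move=> x Ux; apply: derivableD; [exact: df|exact: dg].
apply: (Ck_eq oU) (IH _ _ Cf Cg) => x Ux.
apply/esym/is_derive_derive1/is_deriveD; apply: derive1P => //; first exact: df.
exact: dg.
Qed.

Lemma CkM k U f g : open U -> Ck k U f -> Ck k U g ->
  Ck k U (fun x => f x * g x).
Proof.
move=> oU; elim: k f g => // k IH f g Cf Cg.
have [df Cf'] := Cf; have [dg Cg'] := Cg; split.
  by move=> x Ux; apply: derivableM; [exact: df|exact: dg].
apply: (Ck_eq oU) (CkD oU (IH _ _ (Ck_le Cf) Cg') (IH _ _ (Ck_le Cg) Cf')).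
move=> x Ux; apply/esym/is_derive_derive1.
by apply: (is_deriveM (derive1P (df x Ux) erefl) (derive1P (dg x Ux) erefl)).
Qed.

Lemma CkN k U f : open U -> Ck k U f -> Ck k U (fun x => - f x).
Proof.
move=> oU; elim: k f => //= k IH f [df Cf]; split.
  by move=> x Ux; apply: derivableN; exact: df.
apply: (Ck_eq oU) (IH _ Cf) => x Ux.
by apply/esym/is_derive_derive1/is_deriveN/derive1P => //; exact: df.
Qed.

Lemma Ck_comp k U V f g : open U -> (forall x, U x -> V (g x)) ->
  Ck k V f -> Ck k U g -> Ck k U (f \o g).
Proof.
move=> oU gUV; elim: k f => // k IH f [df Cf'] Cg; have [dg Cg'] := Cg.
have dfg x : U x -> is_derive x 1 (f \o g) (f^`()%classic (g x) * g^`()%classic x).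
  by move=> Ux; apply: is_derive1_comp; apply: derive1P => //;
    [exact: df (gUV _ Ux)|exact: dg].
split; first by move=> x /dfg[].
apply: (Ck_eq oU) (CkM oU (IH _ Cf' (Ck_le Cg)) Cg') => x Ux.
exact/esym/is_derive_derive1/dfg.
Qed.

Lemma Ck_inv k U f : open U -> (forall x, U x -> f x != 0) ->
  Ck k U f -> Ck k U (fun x => (f x)^-1).
Proof.
move=> oU f0; elim: k => // k IH Cf; have [df Cf'] := Cf.
have dfV x : U x -> is_derive x 1 (fun x => (f x)^-1) (- (f x) ^- 2 *: f^`()%classic x).
  by move=> Ux; apply: is_deriveV; [exact: f0|apply: derive1P => //; exact: df].
split; first by move=> x /dfV[].
have Ci := IH (Ck_le Cf).
apply: (Ck_eq oU) (CkM oU (CkN oU (CkM oU Ci Ci)) Cf') => x Ux.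
rewrite (is_derive_derive1 (dfV x Ux)) /= expr2 invfM.
by rewrite /GRing.scale.
Qed.

(** A solution of [h' = a / (b o h)] gains one derivative from each one that it
has, hence is smooth. *)
Lemma smooth_in_ode U V (a b h : R -> R) : open U ->
  smooth_in U a -> smooth_in V b -> (forall x, V x -> b x != 0) ->
  (forall x, U x -> V (h x)) ->
  (forall x, U x -> is_derive x 1 h (a x / b (h x))) ->
  smooth_in U h.
Proof.
move=> oU /smooth_inP Ca /smooth_inP Cb b0 hUV dh; apply/smooth_inP.
elim=> // k IH; split; first by move=> x /dh[].
have Cbh : Ck k U (b \o h) by exact: Ck_comp hUV (Cb k) IH.
have Cbi : Ck k U (fun x => ((b \o h) x)^-1).
  by apply: Ck_inv => // x /hUV /b0.
apply: (Ck_eq oU) (CkM oU (Ca k) Cbi) => x Ux.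
exact/esym/is_derive_derive1/dh.
Qed.

End Smooth.

(** * The implicit local reparametrisation *)

Section LocalGraph.
Variable R : realType.

Lemma derive1_neq0_inj (f : R -> R) (s e : R) :
  (forall x, ball s e x -> derivable f x 1 /\ f^`()%classic x != 0) ->
  forall x y, ball s e x -> ball s e y -> f x = f y -> x = y.
Proof.
move=> fD.
suff main x y : ball s e x -> ball s e y -> x < y -> f x <> f y.
  move=> x y sx sy fxy; case: (ltgtP x y) => // xy.
    by have := main _ _ sx sy xy.
  by have := main _ _ sy sx xy; rewrite fxy.
rewrite /ball/= => sx sy xy fxy.
have xyE z : x <= z <= y -> ball s e z.
  move=> /andP[xz zy]; rewrite /ball/=.
  by move: sx sy; rewrite !ltr_norml; lra.
have dfz z : z \in `]x, y[%R -> is_derive z 1 f (f^`()%classic z).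
  rewrite in_itv /= => /andP[xz zy]; apply: derive1P => //.
  by apply: (fD _ _).1; apply: xyE; rewrite !ltW.
have cf : {within `[x, y], continuous f}.
  apply: derivable_within_continuous => z; rewrite in_itv /= => zxy.
  by apply: (fD _ _).1; exact: xyE.
have [z zxy] := MVT xy dfz cf.
move: zxy; rewrite in_itv /= => /andP[xz zy].
have /xyE/fD[_ /negbTE dz0] : x <= z <= y by rewrite !ltW.
rewrite fxy subrr => /esym/eqP; rewrite mulf_eq0 dz0 subr_eq0.
by rewrite gt_eqF.
Qed.

(** Solving [f1 s = f2 t] for [s]: since [f1] is a local diffeomorphism at [s0],
the solutions near [s0] form the graph of a smooth function. *)
Lemma local_graph (f1 f2 : R -> R) (s0 t0 : R) :
  smooth_at f1 s0 -> smooth_at f2 t0 -> f1 s0 = f2 t0 ->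
  f1^`()%classic s0 != 0 ->
  exists (h : R -> R) (e : R), [/\ 0 < e, smooth_at h t0, h t0 = s0,
    \forall t \near t0, forall s, ball s0 e s -> f1 s = f2 t -> h t = s
    & \forall t \near t0, f1^`()%classic (h t) != 0 /\
        is_derive t 1 h (f2^`()%classic t / f1^`()%classic (h t))].
Proof.
move=> sf1 sf2 f12 d0.
have d0n : \forall s \near s0, f1^`()%classic s != 0.
  have c0 := smooth_at_continuous (smooth_at_derive1 sf1).
  exact: (cvgr_neq0 _ c0 d0).
have /nbhs_ballP[e /= e0 be] : \forall s \near s0,
    smooth_at f1 s /\ f1^`()%classic s != 0.
  by near=> s; split; near: s => //; exact: smooth_at_near.
have inj := @derive1_neq0_inj f1 s0 e.
have {}inj : forall x y, ball s0 e x -> ball s0 e y -> f1 x = f1 y -> x = y.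
  by apply: inj => x /be[/smooth_at_derivable].
(* the inverse branch through s0; off the image of the ball its value is
   irrelevant *)
pose g y := xget s0 [set s | ball s0 e s /\ f1 s = y].
have gK s : ball s0 e s -> g (f1 s) = s.
  move=> se; rewrite /g; case: xgetP => [x _ [xe fx]|/(_ s)[]//].
  exact: inj.
have ball_near s : ball s0 e s -> \forall x \near s, ball s0 e x.
  by move=> se; apply: (@open_near _ (ball s0 e)) => //; exact: ball_open.
have gKn s : ball s0 e s -> {near s, cancel f1 g}.
  by move=> /ball_near; apply: filterS => x; exact: gK.
have fcn s : ball s0 e s -> {near s, continuous f1}.
  move=> /ball_near; apply: filterS => x /be[sx _].
  exact: smooth_at_continuous.
have b0 : ball s0 e s0 by exact: ballxx.
have [cg fK] := near_can_continuousAcan_sym (gKn _ b0) (fcn _ b0).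
have cf2 : f2 x @[x --> t0] --> f1 s0.
  by rewrite f12; exact: smooth_at_continuous.
have ch : g (f2 x) @[x --> t0] --> s0.
  rewrite -[X in _ --> X](gK _ b0); apply: (@cvg_comp _ _ _ f2 g _ (nbhs (f1 s0))) => //.
  exact: nbhs_singleton cg.
have : \forall t \near t0, [/\ smooth_at f2 t, f1 (g (f2 t)) = f2 t
    & ball s0 e (g (f2 t))].
  near=> t; split; near: t; first exact: smooth_at_near.
    exact: cf2 _ fK.
  by apply: ch; exact: nbhsx_ballx.
move=> /near_open[U [oU Ut0 HU]].
have dh t : U t -> is_derive t 1 (g \o f2)
    (f2^`()%classic t / f1^`()%classic (g (f2 t))).
  move=> /HU[s2 fKt gt]; rewrite mulrC.
  have [s1 d1] := be _ gt.
  apply: is_derive1_comp; last first.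
    by apply: derive1P => //; exact: smooth_at_derivable.
  have := @is_derive_inverse R f1 g (f1^`()%classic (g (f2 t))) (g (f2 t)).
  rewrite fKt; apply => //; [exact: gKn|exact: fcn|].
  by apply: derive1P => //; exact: smooth_at_derivable.
exists (g \o f2), e; split.
- exact: e0.
(* [is_derive_inverse] gives [h' = f2' / (f1' o h)], which bootstraps *)
- exists U; split => //.
  apply: (@smooth_in_ode _ U (ball s0 e) (f2^`()%classic) (f1^`()%classic)) => //.
  + move=> n x /HU[/smooth_at_derive1[W [oW Wx sW]] _ _]; exact: sW.
  + move=> n x /be[/smooth_at_derive1[W [oW Wx sW]] _]; exact: sW.
  + by move=> x /be[].
  + by move=> x /HU[].
- by rewrite /= -f12 gK.
- by near=> t => s se /= <-; exact: gK.
- apply: (@open_near _ U) => // t Ut; split; last exact: dh.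
  by have [_ _ /be[]] := HU t Ut.
Unshelve. all: by end_near. Qed.

End LocalGraph.

(** * Vectors, coordinates and the parameter domains *)

Section Vectors.
Variables (R : realType) (d : nat).
Implicit Types (u v w : 'rV[R]_d) (c : R -> 'rV[R]_d).

Lemma rV_neq0 v : v != 0 -> exists i, v 0 i != 0.
Proof.
move=> v0; apply/existsP; apply: contraNT v0 => /existsPn v0.
by apply/eqP/rowP => i; rewrite mxE; apply/eqP; move: (v0 i); rewrite negbK.
Qed.

Lemma dotv_ge0 v : 0 <= dotv v v.
Proof. by apply: sumr_ge0 => i _; rewrite -expr2 sqr_ge0. Qed.

Lemma dotv_eq0 v : (dotv v v == 0) = (v == 0).
Proof.
apply/idP/eqP => [|->]; last by rewrite /dotv big1// => i _; rewrite mxE mul0r.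
rewrite psumr_eq0 => [/allP h|i _]; last by rewrite -expr2 sqr_ge0.
apply/rowP => i; rewrite mxE; apply/eqP; move: (h i (mem_index_enum i)).
by rewrite /= mulf_eq0 orbb.
Qed.

Lemma dotvZl (a : R) u v : dotv (a *: u) v = a * dotv u v.
Proof.
by rewrite /dotv mulr_sumr; apply: eq_bigr => i _; rewrite mxE mulrA.
Qed.

Lemma dotvC u v : dotv u v = dotv v u.
Proof. by apply: eq_bigr => i _; rewrite mulrC. Qed.

Lemma dotvZr (a : R) u v : dotv v (a *: u) = a * dotv v u.
Proof. by rewrite dotvC dotvZl dotvC. Qed.

Lemma enorm_gt0 v : (0 < enorm v) = (v != 0).
Proof. by rewrite sqrtr_gt0 lt_neqAle dotv_ge0 andbT eq_sym dotv_eq0. Qed.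

Lemma enormZ (a : R) v : enorm (a *: v) = `|a| * enorm v.
Proof.
by rewrite /enorm dotvZl dotvZr mulrA -expr2 sqrtrM ?sqr_ge0// sqrtr_sqr.
Qed.

Definition parallel u v := forall i j, u 0 i * v 0 j = u 0 j * v 0 i.

Lemma parallelC u v : parallel u v -> parallel v u.
Proof. by move=> uv i j; rewrite mulrC -uv mulrC. Qed.

Lemma parallelE u v i : parallel u v -> v 0 i != 0 -> u = (u 0 i / v 0 i) *: v.
Proof.
move=> uv vi0; apply/rowP => j; rewrite mxE.
by rewrite mulrAC uv mulfK.
Qed.

(** The factor of proportionality of two parallel vectors, written without the
choice of a coordinate so as to depend continuously on them. *)
Definition ratio u v : R := dotv u v / dotv v v.

Lemma ratioE u v i : parallel u v -> v 0 i != 0 -> ratio u v = u 0 i / v 0 i.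
Proof.
move=> uv vi0; rewrite /ratio {1}(parallelE uv vi0) dotvZl mulfK//.
by rewrite dotv_eq0; apply: contraNneq vi0 => ->; rewrite mxE.
Qed.

Lemma ratioP u v : parallel u v -> v != 0 -> u = ratio u v *: v.
Proof.
by move=> uv /rV_neq0[i vi0]; rewrite (ratioE uv vi0); exact: parallelE.
Qed.

Lemma parallel_collinear u v w :
  parallel u w -> parallel v w -> u != 0 -> w != 0 -> collinear u v.
Proof.
move=> uw vw u0 w0; exists (ratio v w), (- ratio u w); split.
  apply/orP; right; rewrite oppr_eq0; apply: contra_neq u0 => r0.
  by rewrite (ratioP uw w0) r0 scale0r.
rewrite [in X in X + _](ratioP uw w0) [in X in _ + X](ratioP vw w0) !scalerA.
by rewrite mulrC mulNr scaleNr subrr.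
Qed.

Lemma coord_derive1 c t i : derivable c t 1 ->
  (fun x => c x 0 i)^`()%classic t = c^`()%classic t 0 i.
Proof. by move=> dc; rewrite !derive1E derive_mx// mxE. Qed.

Lemma smooth_at_coord c t i : smooth_at c t -> smooth_at (fun x => c x 0 i) t.
Proof.
move=> [U [oU Ut sc]]; exists U; split => // n x Ux.
have E k : forall y, U y -> (fun x => c x 0 i)^`(k)%classic y
                            = c^`(k)%classic y 0 i.
  elim: k => // k IH y Uy; rewrite !derive1nS -(coord_derive1 i (sc k y Uy)).
  exact: (derivable_open_eq oU IH Uy).2.
apply: (derivable_open_eq oU (fun y Uy => esym (E n y Uy)) Ux).1.
exact: (derivable_mxP _ _ _).1 (sc n x Ux) 0 i.
Qed.

Lemma coord_cvg T (F : set_system T) (FF : Filter F) (f : T -> 'rV[R]_d) v i :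
  f x @[x --> F] --> v -> f x 0 i @[x --> F] --> v 0 i.
Proof.
move=> fv; apply: (@cvg_comp _ _ _ f (fun w : 'rV[R]_d => w 0 i) F _ _ fv).
exact: coord_continuous.
Qed.

Lemma dotv_cvg T (F : set_system T) (FF : Filter F) (f g : T -> 'rV[R]_d) u v :
  f x @[x --> F] --> u -> g x @[x --> F] --> v ->
  dotv (f x) (g x) @[x --> F] --> dotv u v.
Proof.
move=> fu gv; apply: cvg_big => [|i _]; first exact: add_continuous.
by apply: cvgM; apply: coord_cvg.
Qed.

Lemma enorm_cvg T (F : set_system T) (FF : Filter F) (f : T -> 'rV[R]_d) u :
  f x @[x --> F] --> u -> enorm (f x) @[x --> F] --> enorm u.
Proof.
move=> fu; apply: (@cvg_comp _ _ _ _ (@Num.sqrt R) F _ _ (dotv_cvg FF fu fu)).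
exact: sqrt_continuous.
Qed.

Lemma ratio_cvg T (F : set_system T) (FF : Filter F) (f g : T -> 'rV[R]_d) u v :
  v != 0 -> f x @[x --> F] --> u -> g x @[x --> F] --> v ->
  ratio (f x) (g x) @[x --> F] --> ratio u v.
Proof.
move=> v0 fu gv; apply: (@cvgM _ _ F FF (fun x => dotv (f x) (g x))
  (fun x => (dotv (g x) (g x))^-1) _ _ (dotv_cvg FF fu gv)).
apply: (@cvgV _ _ F FF (fun x => dotv (g x) (g x)) _ _ (dotv_cvg FF gv gv)).
by rewrite dotv_eq0.
Qed.

End Vectors.

Section Domains.
Variables (R : realType).
Implicit Types (M : manifold1) (s t : R).

(** A compact set of representatives of the parameters, for the segment and for
the circle alike. *)
Definition period : set R := `[0, 2 * pi].

Lemma twopi_gt0 : 0 < 2 * pi :> R.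
Proof. by rewrite mulr_gt0// pi_gt0. Qed.

Lemma periodE t : period t = (0 <= t <= 2 * pi) :> Prop.
Proof. by rewrite /period/= in_itv. Qed.

Lemma period_dom M : period `<=` @dom R M.
Proof. by case: M. Qed.

Lemma same_sym M s t : same M s t -> same M t s.
Proof.
case: M => [[k ->]|->//]; exists (- k).
by rewrite mulrNz mulNr addrK.
Qed.

Lemma same_trans M s t u : same M s t -> same M t u -> same M s u.
Proof.
case: M => [[k ->] [l ->]|->//]; exists (k + l).
by rewrite intrD (mulrDl k%:~R) addrA.
Qed.

Lemma dom_period M t : dom M t -> exists2 s, period s & same M t s.
Proof.
case: M => [_|tD]; last by exists t.
exists (t - (Num.floor (t / (2 * pi)))%:~R * (2 * pi)); last first.
  by exists (- Num.floor (t / (2 * pi))); rewrite mulrNz mulNr.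
have tE : t = t / (2 * pi) * (2 * pi) by rewrite divfK// gt_eqF// twopi_gt0.
rewrite periodE {1 3}tE -mulrBl pmulr_lge0 ?twopi_gt0// subr_ge0.
rewrite floor_le/= ger_pMl ?twopi_gt0// lerBlDl ltW//.
by have := floorD1_gt (t / (2 * pi)); rewrite intrD.
Qed.

(** The retraction of the line onto the parameter domain turns curves that are
only controlled there into continuous functions on the line. *)
Definition clamp M t : R :=
  if M is Segment then Num.max 0 (Num.min t (2 * pi)) else t.

Lemma clamp_dom M t : dom M (clamp M t).
Proof.
have tp := ltW twopi_gt0.
case: M => //=; rewrite in_itv/= le_max lexx/= ge_max tp/=.
by rewrite ge_min lexx orbT.
Qed.

Lemma clampE M t : dom M t -> clamp M t = t.
Proof.
by case: M => //=; rewrite in_itv/= => /andP[t0 t1]; rewrite min_l// max_r.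
Qed.

Lemma clamp_continuous M : continuous (clamp M).
Proof.
case: M => x; first exact: cvg_id.
apply: (@continuous_max _ _ (fun=> 0) (fun t => Num.min t (2 * pi))).
  exact: cvg_cst.
by apply: (@continuous_min _ _ (fun t => t)); [exact: cvg_id|exact: cvg_cst].
Qed.

(** Evaluates at an actual parameter a property that is known near [t] but not at
[t] itself. *)
Lemma dom_dnbhs M t (P : R -> Prop) : dom M t ->
  (\forall u \near t^', dom M u -> P u) -> exists2 u, dom M u & P u.
Proof.
move=> tD /nbhs_ballP[e/= e0 eP].
(* a step of length at most pi towards the farther end stays inside [0, 2 pi] *)
pose r := Num.min (e / 2) pi.
have r0 : 0 < r by rewrite lt_min pi_gt0 divr_gt0.
have re : r < e by rewrite /r gt_min ltr_pdivrMr// ltr_pMr// ltr1n.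
have rp : r <= pi by rewrite /r ge_min lexx orbT.
have [tle|tgt] := leP t pi.
  have uD : dom M (t + r).
    case: (M) tD => //; rewrite /dom/= !in_itv/= => /andP[t0 _].
    by apply/andP; split; lra.
  exists (t + r) => //; apply: eP => //=.
    by rewrite /ball/= opprD addrA subrr sub0r normrN gtr0_norm.
  by rewrite -subr_eq0 addrAC subrr add0r gt_eqF.
have uD : dom M (t - r).
  case: (M) tD => //; rewrite /dom/= !in_itv/= => /andP[t0 t1].
  by apply/andP; split; lra.
exists (t - r) => //; apply: eP => //=.
  by rewrite /ball/= opprB addrC subrK gtr0_norm.
by rewrite -subr_eq0 addrAC subrr add0r oppr_eq0 gt_eqF.
Qed.

End Domains.

Section Immersions.
Variables (R : realType) (d : nat) (M : manifold1) (c : R -> 'rV[R]_d).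
Hypothesis c_imm : immersion M c.

Lemma imm_smooth t : dom M t -> smooth_at c t.
Proof. by have [sc _ _] := c_imm; exact: smooth_at_on. Qed.

Lemma imm_derivable t : dom M t -> derivable c t 1.
Proof. by move=> /imm_smooth; exact: smooth_at_derivable. Qed.

Lemma imm_cont t : dom M t -> c x @[x --> t] --> c t.
Proof. by move=> /imm_smooth; exact: smooth_at_continuous. Qed.

Lemma imm_derive_cont t : dom M t -> c^`()%classic x @[x --> t] --> c^`()%classic t.
Proof. by move=> /imm_smooth/smooth_at_derive1; exact: smooth_at_continuous. Qed.

Lemma imm_neq0 t : dom M t -> c^`()%classic t != 0.
Proof. by have [_ _ c0] := c_imm; exact: c0. Qed.

Lemma imm_same s t : dom M s -> dom M t -> same M s t -> c s = c t.
Proof. by have [_ cs _] := c_imm; exact: cs. Qed.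

Lemma imm_derive_same s t : dom M s -> dom M t -> same M s t ->
  c^`()%classic s = c^`()%classic t.
Proof.
have := imm_same; case: (M) => [cs _ _ [k ->]|_ _ _ -> //].
have cE x : c (x + k%:~R * (2 * pi)) = c x.
  by apply: esym; apply: (cs x) => //; exists k.
set a := _ * _ in cE *; rewrite !derive1E /derive.
suff -> : (fun h : R => h^-1 *: ((c \o shift (s + a)) (h *: 1) - c (s + a))) =
  (fun h : R => h^-1 *: ((c \o shift s) (h *: 1) - c s)) by [].
by apply/funext => h; rewrite /= addrA !cE.
Qed.

End Immersions.

(** * Tangential coincidences of two curves *)

Section Tangency.
Variables (R : realType) (d : nat) (M : manifold1).
Implicit Types (c : R -> 'rV[R]_d).

(** Unlike the equality of positions alone, this relation separates the branches
of a curve at its crossings. Velocities are compared up to a scalar, possibly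
negative, which makes the relation invariant under reparametrisation and
symmetric in the two curves. *)
Definition tangent_at c1 c2 (t s : R) : Prop :=
  c1 s = c2 t /\ parallel (c2^`()%classic t) (c1^`()%classic s).

Lemma tangent_atC c1 c2 t s : tangent_at c1 c2 t s -> tangent_at c2 c1 s t.
Proof. by move=> [e p]; split; [exact: esym|exact: parallelC]. Qed.

Lemma tangent_at_samer c1 c2 t s s' : immersion M c1 -> dom M s -> dom M s' ->
  same M s s' -> tangent_at c1 c2 t s -> tangent_at c1 c2 t s'.
Proof.
move=> i1 ds ds' ss' [e p]; split.
  by rewrite -(imm_same i1 ds ds' ss').
by rewrite -(imm_derive_same i1 ds ds' ss').
Qed.

Lemma tangent_at_samel c1 c2 t t' s : immersion M c2 -> dom M t -> dom M t' ->
  same M t t' -> tangent_at c1 c2 t s -> tangent_at c1 c2 t' s.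
Proof.
move=> i2 dt dt' tt' /tangent_atC h; apply: tangent_atC.
exact: tangent_at_samer i2 dt dt' tt' h.
Qed.

(** Transversality forbids two branches of [c1] through the same point with the
same tangent line. *)
Lemma tangent_at_unique c1 c2 t s s' : immersion M c1 -> immersion M c2 ->
  finite_transverse_self_intersections M c1 ->
  dom M t -> dom M s -> dom M s' ->
  tangent_at c1 c2 t s -> tangent_at c1 c2 t s' -> same M s s'.
Proof.
move=> i1 i2 [_ tr] dt ds ds' [e p] [e' p']; apply: contrapT => ss'.
apply: (tr s s' ds ds' ss'); first by rewrite e e'.
apply: (@parallel_collinear _ _ _ _ (c2^`()%classic t)); try exact: parallelC.
  exact: imm_neq0 i1 _ ds.
exact: imm_neq0 i2 _ dt.
Qed.

Lemma not_tangent_at c1 c2 t s : ~ tangent_at c1 c2 t s ->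
  (exists i, c1 s 0 i - c2 t 0 i != 0) \/
  (c1 s = c2 t /\ exists i j, c2^`()%classic t 0 i * c1^`()%classic s 0 j -
                 c2^`()%classic t 0 j * c1^`()%classic s 0 i != 0).
Proof.
move=> nts; have [e|ne] := eqVneq (c1 s) (c2 t); last first.
  left; have [|i ci] := @rV_neq0 _ _ (c1 s - c2 t); first by rewrite subr_eq0.
  by exists i; move: ci; rewrite !mxE.
right; split => //; apply: contrapT => nij; apply: nts; split => // i j.
apply/eqP; rewrite -subr_eq0; apply: contrapT => /negP nz; apply: nij.
by exists i, j.
Qed.

Lemma near_apart c1 c2 t s (F : set_system R) (FF : Filter F) i :
  {for s, continuous c1} -> c2 x @[x --> F] --> c2 t ->
  c1 s 0 i - c2 t 0 i != 0 -> \forall x \near s & y \near F, c1 x <> c2 y.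
Proof.
move=> k1 k2 ci.
have cv : (fun p : R * R => c1 p.1 0 i - c2 p.2 0 i) p @[p --> (nbhs s, F)] -->
    c1 s 0 i - c2 t 0 i.
  apply: cvgB; apply: coord_cvg.
    by apply: (@cvg_comp _ _ _ fst c1 _ (nbhs s)); [exact: cvg_fst|exact: k1].
  by apply: (@cvg_comp _ _ _ snd c2 _ F); [exact: cvg_snd|exact: k2].
have nz : \forall z \near (nbhs s, F), c1 z.1 0 i - c2 z.2 0 i != 0.
  exact: (cvgr_neq0 _ cv ci).
near=> z => cz.
have /eqP : c1 z.1 0 i - c2 z.2 0 i != 0 by near: z.
by rewrite cz subrr.
Unshelve. all: by end_near. Qed.

(** Away from the common points this is continuity. At a common point, two
curves that meet again near by have a common secant there; the directions of the
secants converge to the tangents, which are not parallel. *)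
Lemma near_secant_apart c1 c2 t s : derivable c1 s 1 -> derivable c2 t 1 ->
  ~ tangent_at c1 c2 t s -> \forall x \near s & y \near t^', c1 x <> c2 y.
Proof.
move=> d1 d2 /not_tangent_at[[i ci]|[e [i [j cij]]]].
  have k1 := derivable_continuous d1.
  have k2 : c2 x @[x --> t^'] --> c2 t.
    by apply: cvg_within_filter; exact: derivable_continuous d2.
  exact: (@near_apart c1 c2 t s _ _ i k1 k2 ci).
(* the secants are [q t * (t - x)] with a slope q that is continuous at x, so
   that no case distinction is needed when [x] returns to [s] *)
have crt c x k : derivable c x 1 -> exists q : R -> R,
    [/\ forall z, c z 0 k - c x 0 k = q z * (z - x), {for x, continuous q}
      & q x = c^`()%classic x 0 k].
  move=> dc; apply/is_derive1_caratheodory; apply: derive1P.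
    exact: (derivable_mxP _ _ _).1 dc 0 k.
  exact: coord_derive1.
have [p [pE pc px]] := crt c1 s i d1; have [p' [pE' pc' px']] := crt c1 s j d1.
have [q [qE qc qx]] := crt c2 t i d2; have [q' [qE' qc' qx']] := crt c2 t j d2.
have cv : (fun z : R * R => q z.2 * p' z.1 - q' z.2 * p z.1) z
    @[z --> (nbhs s, t^')] --> q t * p' s - q' t * p s.
  have cf (f : R -> R) : {for s, continuous f} ->
      f z.1 @[z --> (nbhs s, t^')] --> f s.
    by move=> fc; apply: (@cvg_comp _ _ _ fst f _ (nbhs s)); [exact: cvg_fst|exact: fc].
  have cs (f : R -> R) : {for t, continuous f} ->
      f z.2 @[z --> (nbhs s, t^')] --> f t.
    move=> fc; apply: (@cvg_comp _ _ _ snd f _ t^'); first exact: cvg_snd.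
    exact: cvg_within_filter.
  by apply: cvgB; (apply: cvgM; [exact: cs|exact: cf]).
rewrite px px' qx qx' in cv.
have nz : \forall z \near (nbhs s, t^'), q z.2 * p' z.1 - q' z.2 * p z.1 != 0.
  exact: (cvgr_neq0 _ cv cij).
have nt : \forall z \near (nbhs s, t^'), z.2 != t.
  exists (setT, [set x | x != t]) => [|[x y] []//]; split; first exact: filterT.
  exact: withinT.
near=> z => cz.
have zt : z.2 != t by near: z.
have /eqP : q z.2 * p' z.1 - q' z.2 * p z.1 != 0 by near: z.
apply; apply: (@mulIf _ (z.2 - t)); first by rewrite subr_eq0.
have Ei : q z.2 * (z.2 - t) = p z.1 * (z.1 - s) by rewrite -qE -pE cz e.
have Ej : q' z.2 * (z.2 - t) = p' z.1 * (z.1 - s) by rewrite -qE' -pE' cz e.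
rewrite mul0r mulrBl mulrAC Ei [X in _ - X]mulrAC Ej; ring.
Unshelve. all: by end_near. Qed.

Lemma near_not_tangent c1 c2 t s : smooth_at c1 s -> smooth_at c2 t ->
  ~ tangent_at c1 c2 t s ->
  \forall x \near s & y \near t, ~ tangent_at c1 c2 y x.
Proof.
move=> s1 s2 /not_tangent_at[[i ci]|[e [i [j cij]]]].
  have ne := @near_apart c1 c2 t s (nbhs t) _ i (smooth_at_continuous s1)
    (smooth_at_continuous s2) ci.
  have {}ne : \forall z \near (nbhs s, nbhs t), c1 z.1 <> c2 z.2 by exact: ne.
  have neP z : c1 z.1 <> c2 z.2 -> ~ tangent_at c1 c2 z.2 z.1 by move=> nz [].
  by near=> z; apply: neP; near: z.
have k1 := smooth_at_continuous (smooth_at_derive1 s1).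
have k2 := smooth_at_continuous (smooth_at_derive1 s2).
have cv : (fun z : R * R => c2^`()%classic z.2 0 i * c1^`()%classic z.1 0 j -
      c2^`()%classic z.2 0 j * c1^`()%classic z.1 0 i) z
    @[z --> (nbhs s, nbhs t)] --> c2^`()%classic t 0 i * c1^`()%classic s 0 j -
                 c2^`()%classic t 0 j * c1^`()%classic s 0 i.
  have cf k : c1^`()%classic z.1 0 k @[z --> (nbhs s, nbhs t)] --> c1^`()%classic s 0 k.
    apply: coord_cvg; apply: (@cvg_comp _ _ _ fst (c1^`()%classic) _ (nbhs s)).
      exact: cvg_fst.
    exact: k1.
  have cs k : c2^`()%classic z.2 0 k @[z --> (nbhs s, nbhs t)] --> c2^`()%classic t 0 k.
    apply: coord_cvg; apply: (@cvg_comp _ _ _ snd (c2^`()%classic) _ (nbhs t)).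
      exact: cvg_snd.
    exact: k2.
  by apply: cvgB; (apply: cvgM; [exact: cs|exact: cf]).
have nz : \forall z \near (nbhs s, nbhs t),
    c2^`()%classic z.2 0 i * c1^`()%classic z.1 0 j -
    c2^`()%classic z.2 0 j * c1^`()%classic z.1 0 i != 0.
  exact: (cvgr_neq0 _ cv cij).
near=> z => -[_ p].
have /eqP : c2^`()%classic z.2 0 i * c1^`()%classic z.1 0 j -
    c2^`()%classic z.2 0 j * c1^`()%classic z.1 0 i != 0 by near: z.
by rewrite p subrr.
Unshelve. all: by end_near. Qed.

End Tangency.

(** * Local smoothness of the tangential coincidence *)

Lemma ball_same (R : realType) (M : manifold1) (s0 s e : R) : 0 < e -> dom M s0 -> same M s s0 ->
  \forall x \near s, dom M x -> exists s', [/\ same M x s', dom M s' & ball s0 e s'].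
Proof.
case: M => [e0 _ [k ->]|e0 _ <-]; last first.
  near=> x => dx; exists x; split => //; near: x; exact: nbhsx_ballx.
near=> x => _; exists (x + k%:~R * (2 * pi)); split => //; first by exists k.
have : ball s e x by near: x; exact: nbhsx_ballx.
by rewrite /ball/= opprD addrACA subrr addr0.
Unshelve. all: by end_near. Qed.

Section Coincidence.
Variables (R : realType) (d : nat) (M : manifold1).
Variables (c1 c2 : R -> 'rV[R]_d).
Hypotheses (i1 : immersion M c1) (i2 : immersion M c2).
Hypothesis tr : finite_transverse_self_intersections M c1.
Hypothesis img : forall t, dom M t -> exists2 s, dom M s & c1 s = c2 t.

Let compact_period : compact (@period R).
Proof. exact: segment_compact. Qed.

(** Otherwise, by compactness, the points of [c2] near [c2 t] would avoid the whole
of [c1]. *)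
Lemma exists_tangent t : dom M t -> exists2 s, period s & tangent_at c1 c2 t s.
Proof.
move=> dt; apply: contrapT => nex.
have cov := (compact_near_coveringP _).1 compact_period.
have H : \forall u \near t^', @period R `<=` (fun s => c1 s <> c2 u).
  apply: (cov _ t^' (fun u s => c1 s <> c2 u)) => s sp.
  apply: near_secant_apart.
  - by apply: imm_derivable i1 _ _; exact: period_dom.
  - exact: imm_derivable i2 _ _.
  - by move=> ts; apply: nex; exists s.
have [|u du nu] := @dom_dnbhs R M t (fun u => @period R `<=` (fun s => c1 s <> c2 u)) dt.
  by apply: filterS H.
have [s ds cs] := img du; have [s' ps' ss'] := dom_period ds.
by apply: (nu s' ps'); rewrite -(imm_same i1 ds (@period_dom R M _ ps') ss').
Qed.

(** Near [t0] every coincidence lies near [s0], up to the identifications of the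
parameter domain: the parameters away from [s0] form a compact set on which
coincidence fails at [t0]. *)
Lemma near_tangent t0 s0 e : 0 < e -> dom M t0 -> dom M s0 ->
  tangent_at c1 c2 t0 s0 ->
  \forall t \near t0, dom M t ->
    exists s, [/\ dom M s, ball s0 e s & tangent_at c1 c2 t s].
Proof.
move=> e0 dt0 ds0 ts0.
have cov := (compact_near_coveringP _).1 compact_period.
pose Q t s := tangent_at c1 c2 t s ->
  exists s', [/\ same M s s', dom M s' & ball s0 e s'].
have H : \forall t \near t0, @period R `<=` (fun s => dom M s -> Q t s).
  apply: (cov _ (nbhs t0) (fun t s => dom M s -> Q t s)) => s sp.
  have ds : dom M s by exact: period_dom.
  have [ts|nts] := pselect (tangent_at c1 c2 t0 s).
    have ss0 := tangent_at_unique i1 i2 tr dt0 ds ds0 ts ts0.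
    have bs := ball_same e0 ds0 ss0.
    exists ([set x | dom M x -> exists s', [/\ same M x s', dom M s' & ball s0 e s']], setT).
      by split => //=; exact: filterT.
    by move=> [x y] /= [h _] dx _; exact: h.
  have nt := near_not_tangent (imm_smooth i1 ds) (imm_smooth i2 dt0) nts.
  by apply: filterS nt => -[x y] /= nxy _ /nxy.
apply: filterS H => t Ht dt.
have [s ps ts] := exists_tangent dt.
have ds : dom M s by exact: period_dom.
have [s' [ss' ds' bs']] := Ht s ps ds ts.
by exists s'; split; [exact: ds'|exact: bs'|exact: tangent_at_samer i1 ds ds' ss' ts].
Qed.

(** One coordinate of [c1] is a local diffeomorphism at [s0], so that the equality
of this coordinate alone already forces the parameter of [c1] to lie on the graph
of a smooth [h]. A coincident parameter exists and lies near [s0], hence it is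
[h t]. *)
Lemma tangent_graph t0 s0 : dom M t0 -> dom M s0 -> tangent_at c1 c2 t0 s0 ->
  exists h : R -> R, [/\ smooth_at h t0, h t0 = s0,
    \forall t \near t0, dom M t -> dom M (h t) /\ tangent_at c1 c2 t (h t)
    & \forall t \near t0, dom M t ->
       is_derive t 1 h (ratio (c2^`()%classic t) (c1^`()%classic (h t)))].
Proof.
move=> dt0 ds0 ts0.
have [i d0] := rV_neq0 (imm_neq0 i1 ds0).
have f12 : c1 s0 0 i = c2 t0 0 i by rewrite ts0.1.
have [] := local_graph (smooth_at_coord i (imm_smooth i1 ds0))
  (smooth_at_coord i (imm_smooth i2 dt0)) f12.
  by rewrite coord_derive1//; exact: imm_derivable i1 _ ds0.
move=> h [e [e0 sh ht0 hn dh]].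
have tn : \forall t \near t0, dom M t -> dom M (h t) /\ tangent_at c1 c2 t (h t).
  near=> t => dt.
  have [//|s [ds bs ts]] : dom M t -> exists s,
      [/\ dom M s, ball s0 e s & tangent_at c1 c2 t s].
    by near: t; exact: near_tangent.
  suff -> : h t = s by [].
  have hs : forall s, ball s0 e s -> c1 s 0 i = c2 t 0 i -> h t = s by near: t.
  by apply: hs => //; rewrite ts.1.
exists h; split => //.
near=> t => dt.
have [//|dht [cht pht]] : dom M t -> dom M (h t) /\ tangent_at c1 c2 t (h t).
  by near: t.
have [n0 iD] : (fun x => c1 x 0 i)^`()%classic (h t) != 0 /\ is_derive t 1 h
   ((fun x => c2 x 0 i)^`()%classic t / (fun x => c1 x 0 i)^`()%classic (h t)).
  by near: t.
have d1 := imm_derivable i1 dht; have d2 := imm_derivable i2 dt.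
by move: n0 iD; rewrite !coord_derive1// => n0; rewrite -(ratioE pht n0).
Unshelve. all: by end_near. Qed.

End Coincidence.

(** * Antiderivatives *)

Section Antiderivative.
Variable R : realType.

Lemma is_derive_0_segment (f : R -> R) (x y : R) :
  (forall z : R, Num.min x y <= z <= Num.max x y -> is_derive z 1 f 0) -> f x = f y.
Proof.
wlog xy : x y / x <= y.
  move=> H df; case: (leP x y) => [/H|/ltW/H H']; first exact.
  by apply/esym/H' => z zxy; apply: df; rewrite minC maxC.
rewrite (min_idPl xy) (max_idPr xy) => df.
have [z|z /=|z _] := @MVT_segment R f (fun=> 0) x y xy.
- by rewrite in_itv/= => /andP[xz zy]; apply: df; rewrite !ltW.
- by apply: derivable_within_continuous => {}z; rewrite in_itv/= => /df[].
by rewrite mul0r => /eqP; rewrite subr_eq0 => /eqP.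
Qed.

Lemma is_derive_0_ball (f : R -> R) (x e : R) :
  (forall y, ball x e y -> is_derive y 1 f 0) ->
  forall y, ball x e y -> f y = f x.
Proof.
move=> df y; rewrite /ball/= ltr_norml => xy; apply: is_derive_0_segment => z.
rewrite ge_min le_max => h; apply: df; rewrite /ball/= ltr_norml.
move/andP: h => [/orP[]h1 /orP[]h2]; lra.
Qed.

(** The integrals from [- r] are antiderivatives on bounded intervals; normalised
at [0] they agree with each other. *)
Lemma ex_antiderivative (f : R -> R) : continuous f ->
  exists F : R -> R, forall x : R, is_derive x 1 F (f x).
Proof.
move=> cf.
pose I r x := (\int[lebesgue_measure]_(t in `[- r, x]) f t)%R : R.
have dI (r x : R) : `|x| < r -> is_derive x 1 (I r) (f x).
  rewrite ltr_norml => /andP[rx xr].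
  have [dI IE] : derivable (I r) x 1 /\ (I r)^`()%classic x = f x.
    apply: (@continuous_FTC1_closed R f (- r) x r) => //; last exact: cf.
    apply: continuous_compact_integrable; first exact: segment_compact.
    exact: continuous_subspaceT.
  exact: derive1P.
have IE (r r' x : R) : `|x| < r -> `|x| < r' -> I r x - I r 0 = I r' x - I r' 0.
  move=> xr xr'.
  suff : I r x - I r' x = I r 0 - I r' 0 by move=> ?; lra.
  apply: (@is_derive_0_segment (fun x => I r x - I r' x)) => z zx.
  have zr : `|z| <= `|x|.
    move: zx; rewrite ge_min le_max => /andP[/orP[]h1 /orP[]h2];
      rewrite ler_norml; have := ler_norm x; have := ler_norm (- x);
      rewrite normrN; lra.
  rewrite -(subrr (f z)); apply: is_deriveB; apply: dI; exact: le_lt_trans zr _.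
exists (fun x => I (`|x| + 1) x - I (`|x| + 1) 0) => x.
pose r := `|x| + 2.
apply: (@near_eq_is_derive _ _ _ (fun y => I r y - I r 0)).
  near=> y; apply: IE; last by rewrite ltrDl.
  have : ball x 1 y by near: y; exact: nbhsx_ballx.
  rewrite /ball/= distrC /r => yx.
  by have := ler_normD (y - x) x; rewrite subrK; lra.
rewrite -[f x]subr0; apply: is_deriveB; apply: dI.
by rewrite ltrDl.
Unshelve. all: by end_near. Qed.

End Antiderivative.

(** * Curves with the same image are reparametrisations of each other *)

Section Reparametrisation.
Variables (R : realType) (d : nat).
Implicit Types (c : R -> 'rV[R]_d).

Section Germs.
Variables (M : manifold1) (c1 c2 : R -> 'rV[R]_d).
Hypotheses (i1 : immersion M c1) (i2 : immersion M c2).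
Hypothesis tr : finite_transverse_self_intersections M c1.
Hypothesis img : forall t, dom M t -> exists2 s, dom M s & c1 s = c2 t.

(** A choice, for each parameter of [c2], of a parameter of [c1] with the same
position and tangent line, and of a smooth solution germ through it. *)
Lemma ex_germs : exists (sigma : R -> R) (h : R -> R -> R), forall t, dom M t ->
  [/\ dom M (sigma t), tangent_at c1 c2 t (sigma t), smooth_at (h t) t,
      h t t = sigma t
    & \forall u \near t, dom M u -> dom M (h t u) /\ tangent_at c1 c2 u (h t u)].
Proof.
have /choice[sigma sP] : forall t, exists s, dom M t ->
    dom M s /\ tangent_at c1 c2 t s.
  move=> t; have [dt|ndt] := pselect (dom M t); last by exists 0.
  have [s /period_dom ds ts] := exists_tangent i1 i2 img dt.
  by exists s => _; split.
have /choice[h hP] : forall t, exists h : R -> R, dom M t ->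
   [/\ smooth_at h t, h t = sigma t &
    \forall u \near t, dom M u -> dom M (h u) /\ tangent_at c1 c2 u (h u)].
  move=> t; have [dt|ndt] := pselect (dom M t); last by exists id.
  have [ds ts] := sP t dt.
  by have [h [sh ht tn _]] := tangent_graph i1 i2 tr img dt ds ts; exists h.
exists sigma, h => t dt.
by have [ds ts] := sP t dt; have [sh ht tn] := hP t dt; split.
Qed.

End Germs.

(** On the segment the coincident parameter is unique, hence locally equal to the
germs; the germs at the end points extend it beyond them. *)
Lemma segment_section c1 c2 :
  immersion Segment c1 -> immersion Segment c2 ->
  finite_transverse_self_intersections Segment c1 ->
  (forall t, dom Segment t -> exists2 s, dom Segment s & c1 s = c2 t) ->
  exists phi : R -> R, forall t, dom Segment t ->
    [/\ smooth_at phi t, dom Segment (phi t) & tangent_at c1 c2 t (phi t)].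
Proof.
move=> i1 i2 tr img.
have [sigma [h hP]] := ex_germs i1 i2 tr img.
pose cl := clamp (R := R) Segment.
have clE t : dom Segment t -> cl t = t by exact: clampE.
have near_dom t0 : dom Segment t0 ->
    \forall t \near t0, dom Segment t \/ cl t = t0.
  rewrite /= in_itv/= => /andP[t0ge t0le].
  have tp := twopi_gt0 R.
  have near_lt (a : R) : a < 2 * pi -> \forall t \near a, t < 2 * pi.
    by move=> lt; apply: open_nbhs_nbhs; split => //; exact: open_lt.
  have near_gt (a : R) : 0 < a -> \forall t \near a, 0 < t.
    by move=> lt; apply: open_nbhs_nbhs; split => //; exact: open_gt.
  have [z|t0gt] := leP t0 0.
    have -> : t0 = 0 by lra.
    apply: filterS (near_lt 0 tp) => t tlt; rewrite in_itv/=.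
    have [tp'|tn] := leP 0 t; first by left; rewrite ltW// tlt.
    by right; rewrite /cl/= min_l ?max_l// ltW.
  have [z|t0lt] := leP (2 * pi) t0.
    have -> : t0 = 2 * pi by lra.
    apply: filterS (near_gt _ tp) => t tlt; rewrite in_itv/=.
    have [tp'|tn] := leP t (2 * pi); first by left; rewrite ltW.
    by right; rewrite /cl/= min_r ?max_r// ltW.
  near=> t; left; rewrite in_itv/=; apply/andP; split; apply: ltW; near: t.
    exact: near_gt.
  exact: near_lt.
(* outside the segment, the germ at the nearest end point *)
exists (fun t => h (cl t) t) => t0 dt0.
have [ds0 ts0 sh0 h0 hn] := hP t0 dt0.
rewrite (clE _ dt0) h0; split; [|exact: ds0|exact: ts0].
apply: smooth_at_near_eq sh0; near=> t.
have [dt|->//] : dom Segment t \/ cl t = t0 by near: t; exact: near_dom.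
have [ds ts _ hs _] := hP t dt.
have [//|dh th] : dom Segment t ->
  dom Segment (h t0 t) /\ tangent_at c1 c2 t (h t0 t) by near: t.
rewrite (clE _ dt) hs.
exact: (tangent_at_unique i1 i2 tr dt dh ds th ts).
Unshelve. all: by end_near. Qed.

(** On the circle the coincident parameter is unique modulo [2 * pi]. The slopes
of the germs form a well defined continuous function, whose antiderivative lifts
the coincident parameter to the line: the set where it does so is open and
closed. *)
Lemma circle_section c1 c2 :
  immersion Circle c1 -> immersion Circle c2 ->
  finite_transverse_self_intersections Circle c1 ->
  (forall t, dom Circle t -> exists2 s, dom Circle s & c1 s = c2 t) ->
  exists phi : R -> R, forall t, dom Circle t ->
    [/\ smooth_at phi t, dom Circle (phi t) & tangent_at c1 c2 t (phi t)].
Proof.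
move=> i1 i2 tr img.
have [sigma [h0 h0P]] := ex_germs i1 i2 tr img.
pose lam t := ratio (c2^`()%classic t) (c1^`()%classic (sigma t)).
have germ t0 s0 : tangent_at c1 c2 t0 s0 -> exists h : R -> R,
   [/\ smooth_at h t0, h t0 = s0, \forall t \near t0, tangent_at c1 c2 t (h t),
    \forall t \near t0, lam t = ratio (c2^`()%classic t) (c1^`()%classic (h t))
    & \forall t \near t0, is_derive (t : R) 1 h (lam t)].
  move=> ts0.
  have [h [sh ht tn dh]] := tangent_graph i1 i2 tr img (I : dom Circle t0)
    (I : dom Circle s0) ts0.
  have tn' : \forall t \near t0, tangent_at c1 c2 t (h t).
    by apply: filterS tn => t /(_ I)[].
  have ln : \forall t \near t0,
      lam t = ratio (c2^`()%classic t) (c1^`()%classic (h t)).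
    apply: filterS tn' => t th; rewrite /lam.
    have [_ ts _ _ _] := h0P t I.
    have ss := tangent_at_unique i1 i2 tr (I : dom Circle t)
      (I : dom Circle (h t)) (I : dom Circle (sigma t)) th ts.
    by rewrite (imm_derive_same i1 I I ss).
  exists h; split; [exact: sh|exact: ht|exact: tn'|exact: ln|].
  by near=> t; rewrite (near ln t)//; near: t; apply: filterS dh => t; apply.
have clam : continuous lam.
  move=> t0; have [_ ts0 _ _ _] := h0P t0 I.
  have [h [sh ht tn ln _]] := germ _ _ ts0.
  rewrite /continuous_at (nbhs_singleton ln).
  pose g t := ratio (c2^`()%classic t) (c1^`()%classic (h t)).
  have gl : {near t0, g =1 lam} by apply: filterS ln => t lt; exact: esym.
  apply: (cvg_trans (near_eq_cvg gl)).
  have ch : c1^`()%classic (h t) @[t --> t0] --> c1^`()%classic (h t0).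
    apply: (@cvg_comp _ _ _ h (c1^`()%classic) _ (nbhs (h t0))).
      exact: smooth_at_continuous.
    exact: (imm_derive_cont i1 (I : dom Circle (h t0))).
  have c2' := imm_derive_cont i2 (I : dom Circle t0).
  exact: (ratio_cvg _ (imm_neq0 i1 (I : dom Circle (h t0))) c2' ch).
have [F dF] := ex_antiderivative clam.
pose phi t := sigma 0 + (F t - F 0).
have dphi (t : R) : is_derive t 1 phi (lam t).
  rewrite -[lam t]add0r; apply: is_deriveD.
  by rewrite -[lam t]subr0; apply: is_deriveB.
have phi_near t0 : exists h : R -> R, [/\ smooth_at h t0,
    tangent_at c1 c2 t0 (h t0),
    \forall t \near t0, tangent_at c1 c2 t (h t)
    & \forall t \near t0, h t - phi t = h t0 - phi t0].
  have [_ ts0 _ _ _] := h0P t0 I.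
  have [h [sh ht tn ln dh]] := germ _ _ ts0.
  exists h; split; [exact: sh|by rewrite ht|exact: tn|].
  have /nbhs_ballP[e /= e0 be] := dh.
  near=> t; apply: (@is_derive_0_ball _ (fun t => h t - phi t) t0 e).
    by move=> y /be dy; rewrite -(subrr (lam y)); apply: is_deriveB.
  by near: t; exact: nbhsx_ballx.
(* near any point, phi differs by a constant from a germ, and takes coincident
   values there exactly when this constant is a multiple of the period *)
pose B := [set t | tangent_at c1 c2 t (phi t)].
have B_near t0 : \forall t \near t0, B t <-> B t0.
  have [h [sh th0 tn hphi]] := phi_near t0.
  have BE t : tangent_at c1 c2 t (h t) -> B t <-> same Circle (h t) (phi t).
    move=> th; split=> [tp|sp]; first exact: tangent_at_unique i1 i2 tr I I I th tp.
    exact: tangent_at_samer i1 I I sp th.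
  near=> t; rewrite (BE t0 th0) BE; last by near: t.
  have E : h t - phi t = h t0 - phi t0 by near: t.
  by split=> -[k kE]; exists k; lra.
have BT : B = setT.
  have /connected_intervalP cR : is_interval [set: R] by [].
  apply: cR.
  - by exists 0; rewrite /B/= /phi subrr addr0; have [] := h0P 0 I.
  - exists B; last by rewrite setTI.
    rewrite openE => t Bt; rewrite /interior.
    by apply: filterS (B_near t) => u uB; exact: uB.2 Bt.
  - exists B; last by rewrite setTI.
    rewrite -[B]setCK; apply: open_closedC.
    rewrite openE => t Bt; rewrite /interior.
    by apply: filterS (B_near t) => u uB Bu; exact: Bt (uB.1 Bu).
exists phi => t0 _; have Bt0 : B t0 by rewrite BT.
split; [|by []|exact: Bt0].
have [h [sh ht tn ln dh]] := germ _ _ Bt0.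
apply: smooth_at_near_eq sh.
have /nbhs_ballP[e /= e0 be] := dh.
near=> t; apply/eqP; rewrite -subr_eq0 -(subrr (phi t0)) -{1}ht; apply/eqP.
apply: (@is_derive_0_ball _ (fun t => h t - phi t) t0 e).
  by move=> y /be dy; rewrite -(subrr (lam y)); apply: is_deriveB.
by near: t; exact: nbhsx_ballx.
Unshelve. all: by end_near. Qed.

(** The coincident parameter is compatible with the identifications of the
domain because the coincidence relation is and determines it up to them. *)
Lemma tangent_section M c1 c2 :
  immersion M c1 -> immersion M c2 ->
  finite_transverse_self_intersections M c1 ->
  (forall t, dom M t -> exists2 s, dom M s & c1 s = c2 t) ->
  exists phi : R -> R, smooth_self_map M phi /\
    forall t, dom M t -> tangent_at c1 c2 t (phi t).
Proof.
move=> i1 i2 tr img.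
have [phi phiP] : exists phi : R -> R, forall t, dom M t ->
    [/\ smooth_at phi t, dom M (phi t) & tangent_at c1 c2 t (phi t)].
  case: M i1 i2 tr img; [exact: circle_section|exact: segment_section].
exists phi; split; last by move=> t /phiP[].
split; first by apply: smooth_on_at => t /phiP[].
  by move=> t /phiP[].
move=> s t ds dt st; have [_ dps tps] := phiP s ds; have [_ dpt tpt] := phiP t dt.
apply: (tangent_at_unique i1 i2 tr dt dps dpt _ tpt).
exact: tangent_at_samel i2 ds dt st tps.
Qed.

(** The coincidence relation being symmetric in the two curves, exchanging them
produces the inverse reparametrisation. *)
Lemma equal_images_equal_in_Bi M c1 c2 :
  immersion M c1 -> immersion M c2 ->
  finite_transverse_self_intersections M c1 ->
  finite_transverse_self_intersections M c2 ->
  (forall t, dom M t -> exists2 s, dom M s & c1 s = c2 t) ->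
  (forall t, dom M t -> exists2 s, dom M s & c2 s = c1 t) ->
  equal_in_Bi M c1 c2.
Proof.
move=> i1 i2 tr1 tr2 img12 img21.
have [phi [sphi tphi]] := tangent_section i1 i2 tr1 img12.
have [psi [spsi tpsi]] := tangent_section i2 i1 tr2 img21.
have [_ dphi _] := sphi; have [_ dpsi _] := spsi.
exists phi; last by move=> t /tphi[].
split => //; exists psi; split => // t dt.
  apply: (tangent_at_unique i2 i1 tr2 (dphi _ dt) (dpsi _ (dphi _ dt)) dt).
    exact: tpsi (dphi _ dt).
  exact: tangent_atC (tphi _ dt).
apply: (tangent_at_unique i1 i2 tr1 (dpsi _ dt) (dphi _ (dpsi _ dt)) dt).
  exact: tphi (dpsi _ dt).
exact: tangent_atC (tpsi _ dt).
Qed.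

End Reparametrisation.

(** * Functionals on a reproducing kernel Hilbert space *)

Section RKHS.
Variables (R : realType) (X : Type) (K : X -> X -> R) (H : rkhs K).
Implicit Types (f g u v : X -> R).
Local Notation S := (rkhs_set H).
Local Notation "<< f , g >>" := (rkhs_dot H f g).
Local Notation N := (rkhs_norm H).

Lemma rkhsZ (a : R) f : S f -> S (fun x => a * f x).
Proof.
move=> Sf; have := rkhs_linear (r := H) a Sf (rkhs0 H).
by congr S; apply/funext => x; rewrite addr0.
Qed.

Lemma rkhsB u v : S u -> S v -> S (u \- v).
Proof.
move=> Su Sv; have := rkhs_linear (r := H) (-1) Sv Su.
by congr S; apply/funext => x; rewrite mulN1r addrC.
Qed.

Lemma rkhs_dot_quadratic (a : R) f g : S f -> S g ->
  << (fun x => a * g x + f x), (fun x => a * g x + f x) >> =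
  a ^+ 2 * << g, g >> + 2 * a * << f, g >> + << f, f >>.
Proof.
move=> Sf Sg; have Sgf := rkhs_linear (r := H) a Sg Sf.
rewrite rkhs_dot_linear// (rkhs_dotC (r := H) Sg Sgf) (rkhs_dotC (r := H) Sf Sgf).
rewrite !rkhs_dot_linear// (rkhs_dotC (r := H) Sg Sf); ring.
Qed.

Lemma rkhs_dot0l g : S g -> << (fun=> 0), g >> = 0.
Proof.
move=> Sg; have := rkhs_dot_linear (r := H) (-1) (rkhs0 H) (rkhs0 H) Sg.
rewrite (_ : (fun x : X => -1 * 0 + 0 : R) = (fun=> 0)); first lra.
by apply/funext => x; rewrite mulr0 addr0.
Qed.

Lemma rkhs_normZ (a : R) f : S f -> N (fun x => a * f x) = `|a| * N f.
Proof.
move=> Sf; have S0 := rkhs0 H.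
have -> : (fun x => a * f x) = (fun x => a * f x + (fun=> 0) x).
  by apply/funext => x; rewrite addr0.
rewrite /rkhs_norm /form_norm rkhs_dot_quadratic// !rkhs_dot0l// mulr0 !addr0.
by rewrite sqrtrM ?sqr_ge0// sqrtr_sqr.
Qed.

Lemma discriminant_le (A B C : R) : 0 <= A ->
  (forall a, 0 <= a ^+ 2 * A + 2 * a * B + C) -> B ^+ 2 <= A * C.
Proof.
rewrite le_eqVlt => /predU1P[<- h|A0 h].
  rewrite mul0r; have [->|B0] := eqVneq B 0; first by rewrite expr0n.
  have := h (- (C + 1) / (2 * B)).
  have -> : 2 * (- (C + 1) / (2 * B)) * B = - (C + 1) by field.
  by rewrite mulr0 add0r; lra.
have := h (- B / A).
have -> : (- B / A) ^+ 2 * A + 2 * (- B / A) * B + C = C - B ^+ 2 / A.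
  by field; rewrite gt_eqF.
by rewrite subr_ge0 ler_pdivrMr// mulrC.
Qed.

Lemma rkhs_cauchy_schwarz f g : S f -> S g ->
  << f, g >> ^+ 2 <= << g, g >> * << f, f >>.
Proof.
move=> Sf Sg; apply: discriminant_le => [|a]; first exact: rkhs_dot_ge0.
rewrite -rkhs_dot_quadratic//; apply: rkhs_dot_ge0; exact: rkhs_linear.
Qed.

Lemma rkhs_normE f : S f -> N f ^+ 2 = << f, f >>.
Proof. by move=> Sf; rewrite sqr_sqrtr// rkhs_dot_ge0. Qed.

Lemma rkhs_norm_ge0 f : 0 <= N f.
Proof. exact: sqrtr_ge0. Qed.

Lemma kernel_diag_ge0 x : 0 <= K x x.
Proof.
have Sx := rkhs_kernel H x.
by rewrite -(rkhs_reproducing (r := H) x Sx) rkhs_dot_ge0.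
Qed.

Lemma rkhs_eval_sqr f x : S f -> f x ^+ 2 <= K x x * << f, f >>.
Proof.
move=> Sf; have Sx := rkhs_kernel H x.
rewrite -{1}(rkhs_reproducing (r := H) x Sf) -(rkhs_reproducing (r := H) x Sx).
exact: rkhs_cauchy_schwarz.
Qed.

Lemma rkhs_eval_le f x : S f -> `|f x| <= Num.sqrt (K x x) * N f.
Proof.
move=> Sf; rewrite -(@ler_pXn2r _ 2)// ?nnegrE ?mulr_ge0 ?sqrtr_ge0//.
rewrite real_normK ?num_real// exprMn sqr_sqrtr ?kernel_diag_ge0//.
by rewrite rkhs_normE// rkhs_eval_sqr.
Qed.

(** Riesz representation in disguise: a minimising sequence [u] of
[J f = <f, f> - 2 l f] is Cauchy by the parallelogram law and its limit
represents [l]. As [l] vanishes on the kernel functions, the first variation of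
[J] along them makes this limit vanish pointwise, so that [J >= 0]. *)
Lemma rkhs_functional_eq0 (l : (X -> R) -> R) :
  (forall (a : R) f g, S f -> S g -> l (fun x => a * f x + g x) = a * l f + l g) ->
  (exists C, forall f, S f -> `|l f| <= C * N f) ->
  (forall x, l (K x) = 0) ->
  forall f, S f -> l f = 0.
Proof.
move=> ll [C lC] lK.
pose J f := << f, f >> - 2 * l f.
have Jlb f : S f -> - C ^+ 2 <= J f.
  move=> Sf; rewrite /J -rkhs_normE//.
  have := lC f Sf; have := ler_norm (l f); have := sqr_ge0 (N f - C).
  rewrite sqrrB -mulr_natl; lra.
pose E := [set J f | f in S].
have infE : has_inf E.
  split; first by exists (J (fun=> 0)), (fun=> 0) => //; exact: rkhs0.
  by exists (- C ^+ 2) => _ [f Sf <-]; exact: Jlb.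
pose m := inf E.
have Jm f : S f -> m <= J f by move=> Sf; apply: (ge_inf infE.2); exists f.
have /choice[u uP] : forall n, exists u, S u /\ J u < m + n.+1%:R^-1.
  move=> n; have [|_ [f Sf <-] Jf] := @inf_adherent _ E n.+1%:R^-1 _ infE.
    by rewrite invr_gt0.
  by exists f.
have Jquad (a : R) f g : S f -> S g -> J (fun x => a * g x + f x) =
    a ^+ 2 * << g, g >> + 2 * a * (<< f, g >> - l g) + J f.
  by move=> Sf Sg; rewrite /J rkhs_dot_quadratic// ll//; ring.
(* the parallelogram law, the midpoint being at least as high as the infimum *)
have par f g : S f -> S g -> << f \- g, f \- g >> <= 2 * (J f + J g) - 4 * m.
  move=> Sf Sg; have Sd := rkhsB Sg Sf.
  have fE : f = (fun x => 1 * (f \- g) x + g x).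
    by apply/funext => x /=; rewrite mul1r subrK.
  have h1 := Jquad 2^-1 g (f \- g) Sg (rkhsB Sf Sg).
  have h2 := Jquad 1 g (f \- g) Sg (rkhsB Sf Sg).
  rewrite -fE in h2.
  have := Jm _ (rkhs_linear (r := H) 2^-1 (rkhsB Sf Sg) Sg).
  rewrite h1 h2 expr1n; set B := _ - l _; set D := << _, _ >>.
  have -> : 2^-1 ^+ 2 * D + 2 * 2^-1 * B + J g = D / 4 + B + J g by field.
  lra.
have uC : forall e : R, 0 < e -> exists n0 : nat, forall i j : nat,
    (n0 <= i)%N -> (n0 <= j)%N -> form_norm (rkhs_dot H) (u i \- u j) < e.
  move=> e e0; have e4 : 0 < e ^+ 2 / 4 by rewrite divr_gt0// exprn_gt0.
  have [n0 _ n0P] := cvgr_lt (0 : R) (@cvg_harmonic R) _ e4.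
  exists n0 => i j /n0P/= hi /n0P/= hj.
  have [Si Ji] := uP i; have [Sj Jj] := uP j.
  rewrite -(@ltr_pXn2r _ 2)// ?nnegrE ?sqrtr_ge0//; last exact: ltW.
  rewrite (rkhs_normE (rkhsB Si Sj)).
  apply: le_lt_trans (par _ _ Si Sj) _.
  move: hi hj; rewrite /harmonic/=; move: (_^-1) (_^-1) (J _) (J _) Ji Jj => p q Ju Jv; lra.
have [h Sh hN] := rkhs_complete (fun n => (uP n).1) uC.
(* the first variation of J at [u n] along [K x] is twice [u n x], as
   [l (K x)] vanishes; it is small since [u n] nearly minimises J *)
have h0 x : h x = 0.
  apply/eqP; rewrite -sqrf_eq0 -[_ == 0]negbK; apply/negP => hx.
  have {}hx : 0 < h x ^+ 2 by rewrite lt_neqAle sqr_ge0 eq_sym hx.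
  pose b n := 2 * K x x * (harmonic n + N (u n \- h) ^+ 2) : R.
  have b0 : b n @[n --> \oo] --> 0.
    rewrite -[X in _ --> X](mulr0 (2 * K x x)).
    apply: cvgM; first exact: cvg_cst.
    rewrite -[X in _ --> X](addr0 0); apply: cvgD; first exact: cvg_harmonic.
    rewrite -[X in _ --> X](mulr0 0); under eq_fun do rewrite expr2.
    by apply: cvgM; exact: hN.
  have [n _ /(_ n (leqnn n))/=] := cvgr_lt _ b0 _ hx.
  have [Su Ju] := uP n.
  have hux := rkhs_eval_sqr x (rkhsB Su Sh).
  have ux : u n x ^+ 2 <= K x x * n.+1%:R^-1.
    rewrite -(rkhs_reproducing (r := H) x Su).
    apply: discriminant_le => [|a]; first exact: kernel_diag_ge0.
    have := Jm _ (rkhs_linear (r := H) a (rkhs_kernel H x) Su).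
    rewrite Jquad//; last exact: rkhs_kernel.
    rewrite lK subr0 (rkhs_reproducing x (rkhs_kernel H x)).
    move: (_^-1) (J _) << _, _ >> Ju => p q r Ju; lra.
  rewrite /b rkhs_normE; last exact: rkhsB.
  rewrite /= in hux *.
  have k0 := kernel_diag_ge0 x; move: hux ux; rewrite /harmonic/=.
  have := sqr_ge0 (2 * u n x - h x).
  move: << _, _ >> (_^-1) (u n x) => D p v hv hux ux.
  have hle : h x ^+ 2 <= 2 * v ^+ 2 + 2 * (v - h x) ^+ 2 by nra.
  lra.
have m0 : 0 <= m.
  rewrite leNgt; apply/negP => m0.
  pose b n := harmonic n + 2 * `|C| * N (u n) : R.
  have b0 : b n @[n --> \oo] --> 0.
    rewrite -[X in _ --> X](addr0 0); apply: cvgD; first exact: cvg_harmonic.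
    rewrite -[X in _ --> X](mulr0 (2 * `|C|)).
    apply: cvgM; first exact: cvg_cst.
    have -> : (fun n => N (u n)) = (fun n => form_norm (rkhs_dot H) (u n \- h)).
      apply/funext => n; congr (form_norm _ _).
      by apply/funext => x /=; rewrite h0 subr0.
    exact: hN.
  have mN : 0 < - m by rewrite oppr_gt0.
  have [n _ /(_ n (leqnn n))/=] := cvgr_lt _ b0 _ mN.
  have [Su Ju] := uP n; rewrite /b /harmonic /= => bm.
  have := lC _ Su; have := ler_norm (l (u n)); have := rkhs_dot_ge0 (r := H) Su.
  have := rkhs_norm_ge0 (u n); have := ler_norm C.
  move: Ju bm; rewrite /J; move: (_^-1) (l _) << _, _ >> (N _).
  move=> p v D q Ju bm Cn q0 D0 vn vC.
  have : C * q <= `|C| * q by rewrite ler_wpM2r.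
  lra.
move=> f Sf; apply/eqP; rewrite -sqrf_eq0 eq_le sqr_ge0 andbT.
have -> : l f ^+ 2 = (- l f) ^+ 2 by rewrite sqrrN.
rewrite -(mulr0 << f, f >>); apply: discriminant_le => [|a].
  exact: rkhs_dot_ge0.
have := le_trans m0 (Jm _ (rkhs_linear (r := H) a Sf (rkhs0 H))).
rewrite Jquad//; last exact: rkhs0.
have E0 : (fun x : X => -1 * 0 + 0 : R) = (fun=> 0).
  by apply/funext => x; rewrite mulr0 addr0.
have l0 : l (fun=> 0) = 0.
  by have := ll (-1) _ _ (rkhs0 H) (rkhs0 H); rewrite E0; lra.
by rewrite /J l0 !rkhs_dot0l//; [lra|exact: rkhs0].
Qed.

End RKHS.

(** * Integration along a curve *)

Section PeriodIntegral.
Variable R : realType.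
Implicit Types f g : R -> R.
Local Notation mu := (@lebesgue_measure R).

Definition integral_period f : R := (\int[mu]_(t in @period R) f t)%R.

Lemma integrable_period f : continuous f ->
  mu.-integrable (@period R) (EFin \o f).
Proof.
move=> cf; apply: continuous_compact_integrable; first exact: segment_compact.
exact: continuous_subspaceT.
Qed.

Lemma measurable_period : measurable (@period R).
Proof. exact: measurable_itv. Qed.

Lemma integral_period_eq f g : (forall t, period t -> f t = g t) ->
  integral_period f = integral_period g.
Proof. by move=> fg; apply: eq_Rintegral => t /set_mem; exact: fg. Qed.

Lemma integral_period_linear (a : R) f g : continuous f -> continuous g ->
  integral_period (fun t => a * f t + g t) =
  a * integral_period f + integral_period g.
Proof.
move=> cf cg; have mp := measurable_period.
have caf : continuous (fun t => a * f t).
  by move=> t; apply: cvgM; [exact: cvg_cst|exact: cf].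
rewrite /integral_period RintegralD//; try exact: integrable_period.
by rewrite RintegralZl//; exact: integrable_period.
Qed.

Lemma integral_period_le f g : continuous f -> continuous g ->
  (forall t, period t -> f t <= g t) -> integral_period f <= integral_period g.
Proof.
move=> cf cg fg; apply: le_Rintegral => //; try exact: integrable_period.
exact: measurable_period.
Qed.

Lemma integral_period_norm f : continuous f ->
  `|integral_period f| <= integral_period (fun t => `|f t|).
Proof.
move=> cf; apply: le_normr_Rintegral; first exact: measurable_period.
exact: integrable_period.
Qed.

Lemma integral_period_FTC f (F : R -> R) : continuous f ->
  (forall t, period t -> {for t, continuous F}) ->
  (forall t : R, 0 < t -> t < 2 * pi -> is_derive t 1 F (f t)) ->
  integral_period f = F (2 * pi) - F 0.
Proof.
move=> cf cF dF; have tp := twopi_gt0 R.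
have cF0 : F x @[x --> 0] --> F 0 by apply: cF; rewrite periodE lexx ltW.
have cF1 : F x @[x --> 2 * pi] --> F (2 * pi).
  by apply: cF; rewrite periodE lexx ltW.
rewrite /integral_period /Rintegral (@continuous_FTC2 R f F 0 (2 * pi) tp)//.
- exact: continuous_subspaceT.
- split.
  + by move=> t; rewrite in_itv/= => /andP[t0 t1]; have [] := dF t t0 t1.
  + exact: cvg_at_right_filter.
  + exact: cvg_at_left_filter.
- move=> t; rewrite in_itv/= => /andP[t0 t1].
  exact: is_derive_derive1 (dF t t0 t1).
Qed.

(** The antiderivative is monotone; equal values at both ends would make it
constant on the period, against its positive slope at [t0]. *)
Lemma integral_period_gt0 f t0 : continuous f ->
  (forall t, period t -> 0 <= f t) -> period t0 -> 0 < f t0 ->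
  0 < integral_period f.
Proof.
move=> cf f0 pt0 ft0; have [F dF] := ex_antiderivative cf.
have tp := twopi_gt0 R.
have dFt t : derivable F t 1 by have [] := dF t.
have cF t : {for t, continuous F} by exact: derivable_continuous.
rewrite (@integral_period_FTC f F)// subr_gt0.
have Fle x y : period x -> period y -> x <= y -> F x <= F y.
  move=> px py xy; apply: (@ger0_derive1_le_cc R F 0 (2 * pi)) => //.
  - move=> t; rewrite in_itv/= => /andP[h0 h1].
    by rewrite (is_derive_derive1 (dF t)); apply: f0; rewrite periodE !ltW.
  - exact: continuous_subspaceT.
have p0 : @period R 0 by rewrite periodE lexx ltW.
have p1 : @period R (2 * pi) by rewrite periodE lexx ltW.
rewrite lt_neqAle Fle ?ltW// andbT; apply/eqP => F01.
have Fc t : period t -> F t = F 0.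
  move=> pt; move: (pt); rewrite periodE => /andP[t0' t1'].
  by apply/eqP; rewrite eq_le {1}F01 !Fle.
have [|u pu fu] := @dom_dnbhs R Segment t0 (fun u => F u - F t0 <> 0) pt0.
  have [q [qE qc qt0]] := (is_derive1_caratheodory F t0 (f t0)).1 (dF t0).
  have qn : \forall u \near t0^', q u != 0.
    apply: cvg_within; apply: (cvgr_neq0 _ qc); by rewrite qt0 gt_eqF.
  have un : \forall u \near t0^', u != t0 by exact: withinT.
  near=> u => _; rewrite qE; apply/eqP; rewrite mulf_neq0//; near: u => //.
  by apply: filterS un => u; rewrite subr_eq0.
by apply: fu; rewrite !Fc// subrr.
Unshelve. all: by end_near. Qed.

End PeriodIntegral.

(** * The varifold of an immersed curve *)

Section CurveVarifold.
Variables (R : realType) (d : nat).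
Local Notation PD := (pos_dir R d).

Definition normalize (u : 'rV[R]_d) : 'rV[R]_d := (enorm u)^-1 *: u.

Lemma normalize_sphere u : u != 0 -> sphere R d (normalize u).
Proof.
rewrite -enorm_gt0 => u0.
rewrite /sphere/= /normalize enormZ ger0_norm ?invr_ge0 ?ltW//.
by rewrite mulVf// gt_eqF.
Qed.

Lemma normalize_cvg T (F : set_system T) (FF : Filter F) (f : T -> 'rV[R]_d) (u : 'rV[R]_d) :
  u != 0 -> f x @[x --> F] --> u -> normalize (f x) @[x --> F] --> normalize u.
Proof.
move=> u0 fu; apply: (@cvgZ _ _ _ F FF (fun x => (enorm (f x))^-1) f) => //.
apply: (@cvgV _ _ F FF (fun x => enorm (f x)) _ _ (enorm_cvg FF fu)).
by rewrite gt_eqF// enorm_gt0.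
Qed.

Lemma normalizeZ (a : R) (u : 'rV[R]_d) : a != 0 ->
  normalize (a *: u) = Num.sg a *: normalize u.
Proof.
move=> a0; rewrite /normalize enormZ invfM !scalerA; congr (_ *: _).
have -> : `|a|^-1 = a^-1 * Num.sg a.
  move: a0; case: (ltrgtP a 0) => // a0 _.
    by rewrite ltr0_norm// ltr0_sg// invrN mulrN1.
  by rewrite gtr0_norm// gtr0_sg// mulr1.
by move: (enorm u)^-1 => n; field.
Qed.

Lemma eval_dirE (omega : PD -> R) x (v : sphere R d) :
  eval_dir omega x (set_val v) = omega (x, v).
Proof. by rewrite /eval_dir valK. Qed.

Section Lift.
Variables (M : manifold1) (c : R -> 'rV[R]_d).
Hypothesis c_imm : immersion M c.

Let c'0 t : c^`()%classic (clamp M t) != 0.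
Proof. by apply: imm_neq0 c_imm _ _; exact: clamp_dom. Qed.

(** The position and the unit tangent, clamped to the parameter domain so as to be
continuous on the whole line. The varifold is the image under this lift of the
arc length over one period. *)
Definition tangent_dir t : sphere R d :=
  SigSub (mem_set (normalize_sphere (c'0 t))).

Definition lift t : PD := (c (clamp M t), tangent_dir t).

Definition speed t : R := enorm (c^`()%classic (clamp M t)).

Lemma tangent_dirE t : set_val (tangent_dir t) = normalize (c^`()%classic (clamp M t)).
Proof. by []. Qed.

Lemma speed_gt0 t : 0 < speed t.
Proof. by rewrite enorm_gt0. Qed.

Let cvg_clamp (f : R -> 'rV[R]_d) : (forall t, dom M t -> {for t, continuous f}) ->
  continuous (fun t => f (clamp M t)).
Proof.
move=> cf t; apply: (@cvg_comp _ _ _ (clamp M) f _ (nbhs (clamp M t))).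
  exact: clamp_continuous.
by apply: cf; exact: clamp_dom.
Qed.

Lemma speed_continuous : continuous speed.
Proof.
move=> t; apply: enorm_cvg.
by apply: (@cvg_clamp (c^`()%classic)) => {}t dt; exact: imm_derive_cont c_imm _ dt.
Qed.

Lemma lift_continuous : continuous lift.
Proof.
have cc : continuous (fun t => c (clamp M t)).
  by apply: (@cvg_clamp c) => t dt; exact: imm_cont c_imm _ dt.
have cd : continuous tangent_dir.
  apply: continuous_comp_initial => t.
  apply: normalize_cvg; first exact: c'0.
  by apply: (@cvg_clamp (c^`()%classic)) => {}t dt; exact: imm_derive_cont c_imm _ dt.
by move=> t; exact: (cvg_pair (cc t) (cd t)).
Qed.

Lemma density_continuous (omega : PD -> R) : continuous omega ->
  continuous (fun t => omega (lift t) * speed t).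
Proof.
move=> co t; apply: cvgM; last exact: speed_continuous.
apply: (@cvg_comp _ _ _ lift omega _ (nbhs (lift t))); last exact: co.
exact: lift_continuous.
Qed.

Lemma varifoldE omega :
  varifold c omega = integral_period (fun t => omega (lift t) * speed t).
Proof.
apply: integral_period_eq => t pt; have dt := @period_dom R M t pt.
rewrite /lift /speed -eval_dirE tangent_dirE.
by rewrite !clampE.
Qed.

Lemma varifold_linear (a : R) (f g : PD -> R) : continuous f -> continuous g ->
  varifold c (fun p => a * f p + g p) = a * varifold c f + varifold c g.
Proof.
move=> cf cg; rewrite !varifoldE -integral_period_linear; try exact: density_continuous.
by apply: integral_period_eq => t _; ring.
Qed.

Lemma varifold_bound (f g : PD -> R) (B : R) : continuous f -> continuous g ->
  (forall p, `|f p| <= B * g p) -> `|varifold c f| <= B * varifold c g.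
Proof.
move=> cf cg fg; rewrite !varifoldE.
have cfs := density_continuous cf; have cgs := density_continuous cg.
apply: le_trans (integral_period_norm cfs) _.
rewrite -[leRHS]addr0.
have -> : 0 = integral_period (fun=> 0) :> R.
  by rewrite /integral_period Rintegral_cst ?mul0r//; exact: measurable_period.
rewrite -integral_period_linear//; last by move=> t; exact: cvg_cst.
apply: integral_period_le.
- by move=> t; apply: cvg_norm; exact: cfs.
- move=> t; apply: cvgD; last exact: cvg_cst.
  by apply: cvgM; [exact: cvg_cst|exact: cgs].
move=> t _; rewrite addr0 normrM mulrA (ger0_norm (ltW (speed_gt0 t))).
by rewrite ler_wpM2r// ltW// speed_gt0.
Qed.

Lemma varifold_eq0 (f : PD -> R) : (forall t, period t -> f (lift t) = 0) ->
  varifold c f = 0.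
Proof.
move=> f0; rewrite varifoldE (@integral_period_eq _ _ (fun=> 0)).
  by rewrite /integral_period Rintegral_cst ?mul0r//; exact: measurable_period.
by move=> t pt; rewrite f0// mul0r.
Qed.

Lemma varifold_gt0 (f : PD -> R) t0 : continuous f ->
  (forall t, period t -> 0 <= f (lift t)) -> period t0 -> 0 < f (lift t0) ->
  0 < varifold c f.
Proof.
move=> cf f0 pt0 ft0; rewrite varifoldE.
apply: (integral_period_gt0 (density_continuous cf) _ pt0).
  by move=> t pt; rewrite mulr_ge0 ?f0// ltW// speed_gt0.
by rewrite mulr_gt0// speed_gt0.
Qed.

End Lift.
End CurveVarifold.

(** * Testing varifolds against tensor products *)

Section Tensor.
Variables (R : realType) (d : nat) (gamma : R -> R).
Hypothesis gamma_C1 : C1_on `[-1, 1] gamma.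
Local Notation PD := (pos_dir R d).
Local Notation zonal := (@zonal_kernel R d gamma).

Lemma sphere_dotv (u : sphere R d) : dotv (set_val u) (set_val u) = 1.
Proof.
have := set_valP u; rewrite /sphere/= /enorm => uE.
by rewrite -(sqr_sqrtr (dotv_ge0 (set_val u))) set_valE uE expr1n.
Qed.

Lemma dotv_sphere_itv (u v : sphere R d) :
  -1 <= dotv (set_val u) (set_val v) <= 1.
Proof.
have E (e : R) : dotv (set_val u + e *: set_val v) (set_val u + e *: set_val v) =
    1 + e ^+ 2 + 2 * e * dotv (set_val u) (set_val v).
  transitivity (dotv (set_val u) (set_val u) + e ^+ 2 * dotv (set_val v) (set_val v)
      + 2 * e * dotv (set_val u) (set_val v)); last by rewrite !sphere_dotv mulr1.
  rewrite /dotv !mulr_sumr -!big_split/=; apply: eq_bigr => i _; rewrite !mxE; ring.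
have := dotv_ge0 (set_val u + 1 *: set_val v); rewrite E.
have := dotv_ge0 (set_val u + -1 *: set_val v); rewrite E.
by rewrite sqrrN !expr1n => h1 h2; apply/andP; split; lra.
Qed.

Lemma zonal_continuous (v : sphere R d) : continuous (zonal v).
Proof.
have [U [g [oU IU gE dg]]] := gamma_C1 => u.
have itv (w : sphere R d) : U (dotv (set_val v) (set_val w)).
  by apply: IU; have := dotv_sphere_itv v w; rewrite /= in_itv.
have -> : zonal v = (fun w : sphere R d => g (dotv (set_val v) (set_val w))).
  by apply/funext => w; apply: gE; have := dotv_sphere_itv v w; rewrite /= in_itv.
apply: (@cvg_comp _ _ _ (fun w : sphere R d => dotv (set_val v) (set_val w)) g _
  (nbhs (dotv (set_val v) (set_val u)))).
  have cv : set_val w @[w --> u] --> set_val u.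
    exact: (@initial_continuous _ _ (set_val : sphere R d -> 'rV[R]_d) u).
  exact: (dotv_cvg _ (cvg_cst (set_val v)) cv).
by apply: derivable_continuous; apply: (dg _ _).1.
Qed.

Lemma cont_comb (T : topologicalType) (a : R) (f g : T -> R) :
  continuous f -> continuous g -> continuous (fun x => a * f x + g x).
Proof.
move=> cf cg x; apply: cvgD; last exact: cg.
by apply: cvgM; [exact: cvg_cst|exact: cf].
Qed.

Definition tensor (f : 'rV[R]_d -> R) (v : sphere R d) (p : PD) : R :=
  f p.1 * zonal v p.2.

Lemma zonal_snd_continuous (v : sphere R d) : continuous (fun p : PD => zonal v p.2).
Proof.
move=> p; apply: (@cvg_comp _ _ _ snd (zonal v) _ (nbhs p.2)).
  exact: cvg_snd.
exact: zonal_continuous.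
Qed.

Lemma tensor_continuous f v : continuous f -> continuous (tensor f v).
Proof.
move=> cf p; apply: cvgM; last exact: zonal_snd_continuous.
apply: (@cvg_comp _ _ _ fst f _ (nbhs p.1)); last exact: cf.
exact: cvg_fst.
Qed.

Section Density.
Variables (M : manifold1) (c1 c2 : R -> 'rV[R]_d).
Hypotheses (i1 : immersion M c1) (i2 : immersion M c2).

(** For a fixed direction [v] the difference of the varifolds is a bounded
functional of the position variable: it vanishes on the kernel functions, hence
on the Hilbert space of [rho], hence on its uniform closure. *)
Lemma varifold_tensor_eq (rho : R -> R) :
  C0_universal (@radial_kernel R d rho) ->
  (forall q, varifold c1 (varifold_kernel rho gamma q) =
             varifold c2 (varifold_kernel rho gamma q)) ->
  forall f v, C0 f -> varifold c1 (tensor f v) = varifold c2 (tensor f v).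
Proof.
move=> [Hr [HC0 dense]] Vk f v f0.
pose l h := varifold c1 (tensor h v) - varifold c2 (tensor h v).
pose z (p : PD) := `|zonal v p.2|.
have cz : continuous z by move=> p; apply: cvg_norm; exact: zonal_snd_continuous.
pose L := varifold c1 z + varifold c2 z.
have ll (a : R) g h : continuous g -> continuous h ->
    l (fun x => a * g x + h x) = a * l g + l h.
  move=> cg ch; rewrite /l.
  have -> : tensor (fun x => a * g x + h x) v =
      (fun p => a * tensor g v p + tensor h v p).
    by apply/funext => p; rewrite /tensor; ring.
  have [tg th] := (tensor_continuous (v := v) cg, tensor_continuous (v := v) ch).
  rewrite (varifold_linear i1 a tg th) (varifold_linear i2 a tg th).
  by rewrite mulrBr opprD addrACA.
have lb g B : continuous g -> (forall x, `|g x| <= B) -> `|l g| <= B * L.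
  move=> cg gB; apply: le_trans (ler_normB _ _) _; rewrite /L mulrDr.
  have gz p : `|tensor g v p| <= B * z p.
    by rewrite /tensor normrM ler_wpM2r.
  have ct := tensor_continuous (v := v) cg.
  apply: lerD.
    exact: (varifold_bound i1 ct cz gz).
  exact: (varifold_bound i2 ct cz gz).
have HC g : rkhs_set Hr g -> continuous g by move=> /HC0[].
have lH g : rkhs_set Hr g -> l g = 0.
  apply: (rkhs_functional_eq0 (H := Hr)).
  - by move=> a h k Sh Sk; apply: ll; exact: HC.
  - exists (Num.sqrt (rho 0) * L) => h Sh; rewrite mulrAC.
    apply: lb => [|x]; first exact: HC.
    apply: le_trans (rkhs_eval_le x Sh) _.
    suff -> : radial_kernel rho x x = rho 0 by [].
    rewrite /radial_kernel subrr; congr rho.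
    by rewrite /enorm (eqP (_ : dotv 0 0 == 0)) ?dotv_eq0// sqrtr0 expr0n.
  - by move=> y; apply/eqP; rewrite subr_eq0; apply/eqP; exact: (Vk (y, v)).
have [cf _] := f0.
have lfe e : 0 < e -> `|l f| <= e * L.
  move=> e0; have [h Sh fh] := dense f f0 e e0.
  have -> : l f = l (fun x => -1 * h x + f x).
    by rewrite ll//; [rewrite (lH h Sh) mulr0 add0r|exact: HC].
  apply: lb => x.
    exact: (cont_comb (HC h Sh) cf).
  by rewrite mulN1r addrC.
have L0 : 0 <= L.
  by have := lfe 1 ltr01; rewrite mul1r; apply: le_trans.
apply/eqP; rewrite -subr_eq0 -normr_eq0 eq_le normr_ge0 andbT.
apply/ler_addgt0Pr => e e0; rewrite add0r.
apply: le_trans (lfe (e / (L + 1)) _) _; first by rewrite divr_gt0// ltr_wpDl.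
have L1 : 0 < L + 1 by rewrite ltr_wpDl.
rewrite mulrAC ler_pdivrMr//; apply: ler_wpM2l; first exact: ltW.
by rewrite lerDl.
Qed.

End Density.
End Tensor.

(** * Equal varifolds have equal images *)

Lemma dist_cvg (R : realType) d T (F : set_system T) (FF : Filter F)
    (f : T -> 'rV[R]_d) (a p : 'rV[R]_d) :
  f x @[x --> F] --> a -> `|f x - p| @[x --> F] --> `|a - p|.
Proof.
move=> fa; have h : f x - p @[x --> F] --> a - p.
  by apply: cvgB => //; exact: cvg_cst.
exact: (cvg_norm h).
Qed.

Lemma subr_cvg (R : realType) T (F : set_system T) (FF : Filter F)
    (f : T -> R) (r a : R) :
  f x @[x --> F] --> a -> r - f x @[x --> F] --> r - a.
Proof. by move=> fa; apply: cvgB => //; exact: cvg_cst. Qed.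

Section Image.
Variables (R : realType) (d : nat) (gamma : R -> R).
Hypothesis gamma_C1 : C1_on `[-1, 1] gamma.
Hypothesis gamma1_gt0 : 0 < gamma 1.

(** Twice the positive part of [r - |x - p|]. *)
Definition bump (p : 'rV[R]_d) (r : R) (x : 'rV[R]_d) : R :=
  (r - `|x - p|) + `|r - `|x - p| |.

Lemma bump_ge0 p r x : 0 <= bump p r x.
Proof.
rewrite /bump; have := ler_norm (- (r - `|x - p|)); rewrite normrN; lra.
Qed.

Lemma bump_eq0 p r x : r <= `|x - p| -> bump p r x = 0.
Proof.
by move=> h; rewrite /bump ler0_norm ?subrr// subr_le0.
Qed.

Lemma bump_gt0 p r : 0 < r -> 0 < bump p r p.
Proof.
by move=> r0; rewrite /bump subrr normr0 subr0 gtr0_norm// addr_gt0.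
Qed.

Lemma bump_continuous p r : continuous (bump p r).
Proof.
move=> x.
have c1 : r - `|y - p| @[y --> x] --> r - `|x - p|.
  have h : `|y - p| @[y --> x] --> `|x - p| by exact: (dist_cvg _ (@cvg_id _ (nbhs x))).
  exact: (subr_cvg _ h).
exact: (cvgD c1 (cvg_norm c1)).
Qed.

Lemma bump_C0 p r : C0 (bump p r).
Proof.
split; first exact: bump_continuous.
move=> e e0; exists [set x | `|x - p| <= r].
  apply: bounded_closed_compact.
    exists (r + `|p|); split; first by rewrite num_real.
    move=> s rs x /= xr; apply: ltW; apply: le_lt_trans rs.
    by rewrite -(subrK p x) (le_trans (ler_normD _ _))// lerD2r.
  have -> : [set x | `|x - p| <= r] = (fun x : 'rV[R]_d => `|x - p|) @^-1` [set y | y <= r].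
    by [].
  apply: closed_comp; last exact: closed_le.
  by move=> x _; exact: (dist_cvg _ (@cvg_id _ (nbhs x))).
move=> x /= /negP; rewrite -ltNge => xr; rewrite bump_eq0 ?normr0// ltW//.
Qed.

Section Inclusion.
Variables (M : manifold1) (c1 c2 : R -> 'rV[R]_d).
Hypotheses (i1 : immersion M c1) (i2 : immersion M c2).
Hypothesis V12 : forall f v, C0 f ->
  varifold c1 (tensor gamma f v) = varifold c2 (tensor gamma f v).

Let compact_period : compact (@period R).
Proof. exact: segment_compact. Qed.

Let dist_near (c : R -> 'rV[R]_d) (p : 'rV[R]_d) t : {for t, continuous c} -> c t <> p ->
  \forall u \near t & r \near (0 : R)^'+, r <= `|c u - p|.
Proof.
move=> cc /eqP ctp.
have e0 : 0 < `|c t - p| by rewrite normr_gt0 subr_eq0.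
have cv : `|c u - p| @[u --> t] --> `|c t - p|.
  exact: (dist_cvg _ cc).
have h1 : \forall u \near t, `|c t - p| / 2 < `|c u - p|.
  by apply: (cvgr_gt _ cv); rewrite ltr_pdivrMr// ltr_pMr// ltr1n.
have h2 : \forall r \near (0 : R)^'+, r < `|c t - p| / 2.
  by apply: nbhs_right_lt; rewrite divr_gt0.
exists ([set u | `|c t - p| / 2 < `|c u - p|], [set r | r < `|c t - p| / 2]) => //.
by move=> [u r] /= [hu hr]; apply: ltW; apply: lt_trans hr hu.
Qed.

(** Near a simple point [p] of [c1] all tangent lines of [c1] are close to the one
at [p], so that [gamma] takes positive values: a bump at [p], tested in this
direction, has positive mass on [c1], and none on [c2] if [c2] avoids [p]. *)
Lemma simple_point_in_image t0 : dom M t0 -> ~ self_intersections M c1 (c1 t0) ->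
  exists2 s, dom M s & c2 s = c1 t0.
Proof.
wlog pt0 : t0 / period t0.
  move=> H dt0 simple; have [t pt tt] := dom_period dt0.
  have dt : dom M t by exact: period_dom.
  have ct := imm_same i1 dt0 dt tt.
  have [||s ds cs] := H t pt; [exact: dt|by rewrite -ct|].
  by exists s => //; rewrite cs.
move=> dt0 simple; apply: contrapT => nex.
pose p := c1 t0; pose v := tangent_dir i1 t0.
have cov := (compact_near_coveringP _).1 compact_period.
have H2 : \forall r \near (0 : R)^'+, @period R `<=` (fun s => r <= `|c2 s - p|).
  apply: (cov _ (0 : R)^'+ (fun r s => r <= `|c2 s - p|)) => s /(@period_dom R M) ds.
  apply: dist_near; first exact: imm_cont i2 _ ds.
  by move=> cs; apply: nex; exists s.
have H1 : \forall r \near (0 : R)^'+, @period R `<=` (fun t => r <= `|c1 t - p| \/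
    0 < zonal_kernel gamma v (tangent_dir i1 t)).
  apply: (cov _ (0 : R)^'+ (fun r t => r <= `|c1 t - p| \/
    0 < zonal_kernel gamma v (tangent_dir i1 t))) => t pt.
  have dt := @period_dom R M _ pt.
  have [ctp|ctp] := eqVneq (c1 t) p; last first.
    have cc := imm_cont i1 dt.
    have := dist_near cc (elimN eqP ctp).
    by apply: filterS => -[u r] /= h; left.
  have tt0 : same M t t0.
    apply: contrapT => tt0; apply: simple; exists t, t0; split => //.
  have Et : tangent_dir i1 t = v.
    have : set_val (tangent_dir i1 t) = set_val v.
      rewrite !tangent_dirE (clampE dt) (clampE dt0).
      by rewrite (imm_derive_same i1 dt dt0 tt0).
    exact: val_inj.
  have g0 : 0 < zonal_kernel gamma v (tangent_dir i1 t).
    by rewrite Et /zonal_kernel sphere_dotv.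
  have cz : continuous (fun t => zonal_kernel gamma v (tangent_dir i1 t)).
    move=> u; have cl := @lift_continuous _ _ _ _ i1 u.
    exact: (cvg_comp _ _ cl (@zonal_snd_continuous _ _ _ gamma_C1 v (lift i1 u))).
  have h : \forall u \near t, 0 < zonal_kernel gamma v (tangent_dir i1 u).
    exact: (cvgr_gt _ (cz t)).
  exists ([set u | 0 < zonal_kernel gamma v (tangent_dir i1 u)], setT).
    by split; [exact: h|exact: filterT].
  by move=> [u r] /= [hu _]; right.
have H0 : \forall r \near (0 : R)^'+, 0 < r by exact: nbhs_right_gt.
have [r [rH1 rH2 r0]] : exists r : R, [/\
   @period R `<=` (fun t => r <= `|c1 t - p| \/
    0 < zonal_kernel gamma v (tangent_dir i1 t)),
   @period R `<=` (fun s => r <= `|c2 s - p|) & 0 < r].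
  apply: (@filter_ex _ (0 : R)^'+); near=> r; split; near: r; [exact: H1|exact: H2|exact: H0].
have := V12 v (bump_C0 p r).
rewrite (varifold_eq0 (c_imm := i2)); last first.
  move=> t pt; rewrite /tensor /= bump_eq0 ?mul0r//.
  by rewrite clampE; [exact: rH2|exact: period_dom].
move=> V0.
suff : 0 < varifold c1 (tensor gamma (bump p r) v) by rewrite V0 ltxx.
apply: (@varifold_gt0 _ _ _ _ i1 _ _ _ _ pt0).
- by apply: tensor_continuous => //; exact: bump_continuous.
- move=> t pt; rewrite /tensor /= clampE; last exact: period_dom.
  have [h|h] := rH1 t pt; first by rewrite bump_eq0// mul0r.
  by rewrite mulr_ge0// ?bump_ge0// ltW.
rewrite /tensor /= clampE// mulr_gt0 ?bump_gt0//.
by rewrite /zonal_kernel sphere_dotv.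
Unshelve. all: by end_near. Qed.

Lemma near_all_seq (T : choiceType) (F : set_system R) (FF : Filter F)
    (P : T -> R -> Prop) (s : seq T) :
  (forall x, x \in s -> \forall t \near F, P x t) ->
  \forall t \near F, forall x, x \in s -> P x t.
Proof.
elim: s => [|x s IH] sP; first by apply: nearW.
have h1 := sP x (mem_head _ _).
have h2 : \forall t \near F, forall y, y \in s -> P y t.
  by apply: IH => y ys; apply: sP; rewrite in_cons ys orbT.
near=> t => y; rewrite in_cons => /predU1P[->|]; first by near: t.
by move: y; near: t.
Unshelve. all: by end_near. Qed.

Let near_avoid t0 (p : 'rV[R]_d) : dom M t0 -> \forall t \near t0^', c1 t <> p.
Proof.
move=> dt0; have [e|ne] := eqVneq (c1 t0) p; last first.
  have [|i ci] := @rV_neq0 _ _ (c1 t0 - p); first by rewrite subr_eq0.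
  have cv : (c1 t - p) 0 i @[t --> t0] --> (c1 t0 - p) 0 i.
    apply: (@coord_cvg _ _ _ _ _ (fun t => c1 t - p)).
    apply: (@cvgB _ _ _ _ _ c1 (fun=> p)); last exact: cvg_cst.
    exact: (imm_cont i1 dt0).
  apply: cvg_within; apply: filterS (cvgr_neq0 _ cv ci) => t /eqP + cp.
  by rewrite cp subrr mxE.
have [i ci] := rV_neq0 (imm_neq0 i1 dt0).
have dc := imm_derivable i1 dt0.
have [q [qE qc qt0]] := (is_derive1_caratheodory (fun x => c1 x 0 i) t0
  (c1^`()%classic t0 0 i)).1 (derive1P ((derivable_mxP _ _ _).1 dc 0 i) (coord_derive1 i dc)).
have qn : \forall u \near t0^', q u != 0.
  by apply: cvg_within; apply: (cvgr_neq0 _ qc); rewrite qt0.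
have un : \forall u \near t0^', u != t0 by exact: withinT.
near=> u => cu.
have : q u * (u - t0) != 0.
  rewrite mulf_neq0//; first by near: u.
  by rewrite subr_eq0; near: u.
by rewrite -qE cu e subrr eqxx.
Unshelve. all: by end_near. Qed.

(** The simple points are dense in the first curve, since an immersion takes each
of the finitely many multiple values at isolated parameters. *)
Lemma image_subset : finite_set (self_intersections M c1) ->
  forall t0, dom M t0 -> exists2 s, dom M s & c2 s = c1 t0.
Proof.
move=> /finite_seqP[s sE] t0 dt0; apply: contrapT => nex.
have cov := (compact_near_coveringP _).1 compact_period.
have H2 : \forall t \near t0, @period R `<=` (fun u => c2 u <> c1 t).
  apply: (cov _ (nbhs t0) (fun t u => c2 u <> c1 t)) => u /(@period_dom R M) du.
  have [|i ci] := @rV_neq0 _ _ (c2 u - c1 t0).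
    by rewrite subr_eq0; apply/eqP => cu; apply: nex; exists u.
  apply: (@near_apart _ _ c2 c1 t0 u (nbhs t0) _ i).
  - exact: imm_cont i2 _ du.
  - exact: imm_cont i1 _ dt0.
  - by move: ci; rewrite !mxE.
have H1 : \forall t \near t0^', forall p, p \in s -> c1 t <> p.
  by apply: near_all_seq => p _; exact: near_avoid.
have [|t dt [nt ns]] := @dom_dnbhs R M t0
    (fun t => (@period R `<=` (fun u => c2 u <> c1 t)) /\ forall p, p \in s -> c1 t <> p) dt0.
  have H2' : \forall t \near t0^', @period R `<=` (fun u => c2 u <> c1 t).
    exact: cvg_within H2.
  by near=> t => _; split; near: t.
have [|u du cu] := @simple_point_in_image t dt.
  by rewrite sE => /= ct; exact: ns _ ct erefl.
have [u' pu' uu'] := dom_period du.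
by apply: (nt u' pu'); rewrite -(imm_same i2 du (@period_dom R M _ pu') uu').
Unshelve. all: by end_near. Qed.

End Inclusion.
End Image.

(** * Invariance under reparametrisation *)

Section Invariance.
Variables (R : realType) (d : nat) (M : manifold1) (c1 c2 : R -> 'rV[R]_d).
Hypotheses (i1 : immersion M c1) (i2 : immersion M c2).
Variables (phi : R -> R) (phi_diffeo : diffeo M phi).
Hypothesis c2E : forall t, dom M t -> c2 t = c1 (phi t).
Variable omega : pos_dir R d -> R.
Hypothesis omega_cont : continuous omega.
Hypothesis omega_even : forall x u v, set_val u = - set_val v ->
  omega (x, u) = omega (x, v).

Let tp := twopi_gt0 R.

Let dphi t : dom M t -> dom M (phi t).
Proof. by have [[_ h _] _] := phi_diffeo; exact: h. Qed.

Let sphi t : dom M t -> smooth_at phi t.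
Proof. by have [[h _ _] _] := phi_diffeo; exact: smooth_at_on. Qed.

Let interior_dom (t : R) : 0 < t -> t < 2 * pi -> \forall u \near t, dom M u.
Proof.
move=> t0 t1; have : \forall u \near t, u \in `]0, (2 * pi)[%R.
  by apply: near_in_itvoo; rewrite in_itv/= t0.
apply: filterS => u; rewrite in_itv/= => /andP[u0 u1].
by apply: period_dom; rewrite periodE !ltW.
Qed.

(** On the segment [c2] is known to be [c1 o phi] on the parameter domain only, so
that velocities are compared in its interior. *)
Let chain (t : R) : 0 < t -> t < 2 * pi ->
  c2^`()%classic t = phi^`()%classic t *: c1^`()%classic (phi t).
Proof.
move=> t0 t1; have idm := interior_dom t0 t1.
have dt : dom M t := nbhs_singleton idm.
apply/rowP => i; rewrite mxE mulrC.
have d1 := imm_derivable i1 (dphi dt); have d2 := imm_derivable i2 dt.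
rewrite -(coord_derive1 i d1) -(coord_derive1 i d2).
apply: is_derive_derive1.
have dc : is_derive t 1 ((fun x => c1 x 0 i) \o phi)
    ((fun x => c1 x 0 i)^`()%classic (phi t) * phi^`()%classic t).
  apply: is_derive1_comp; apply: derive1P => //.
    exact: (derivable_mxP _ _ _).1 d1 0 i.
  exact: smooth_at_derivable (sphi dt).
apply: near_eq_is_derive dc.
by apply: filterS idm => u du; rewrite /= c2E.
Qed.

Let phi'_neq0 (t : R) : 0 < t -> t < 2 * pi -> phi^`()%classic t != 0.
Proof.
move=> t0 t1; have dt : dom M t := nbhs_singleton (interior_dom t0 t1).
apply/eqP => p0; have := imm_neq0 i2 dt.
by rewrite chain// p0 scale0r eqxx.
Qed.

Let density1 t := omega (lift i1 t) * speed M c1 t.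
Let density2 t := omega (lift i2 t) * speed M c2 t.

Let densityE (t : R) : 0 < t -> t < 2 * pi ->
  density2 t = density1 (phi t) * `|phi^`()%classic t|.
Proof.
move=> t0 t1; have dt : dom M t := nbhs_singleton (interior_dom t0 t1).
have p0 := phi'_neq0 t0 t1; have cE := chain t0 t1.
rewrite /density2 /density1 /speed (clampE dt) (clampE (dphi dt)) cE enormZ.
rewrite -mulrA [_ * enorm _]mulrC; congr (_ * _).
rewrite /lift (clampE dt) (clampE (dphi dt)) (c2E dt).
have dirE : set_val (tangent_dir i2 t) =
    Num.sg (phi^`()%classic t) *: set_val (tangent_dir i1 (phi t)).
  by rewrite !tangent_dirE (clampE dt) (clampE (dphi dt)) cE normalizeZ.
move: dirE; case: (sgrP (phi^`()%classic t)) p0 => [|_ _|_ _]; first by [].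
  by rewrite scale1r => /val_inj ->.
by rewrite scaleN1r; exact: omega_even.
Qed.

(** The derivative of the reparametrisation never vanishes inside the period, so
it has a constant sign there. *)
Let ex_sign : exists2 e : R, e = 1 \/ e = -1 &
  forall t : R, 0 < t -> t < 2 * pi -> `|phi^`()%classic t| = e * phi^`()%classic t.
Proof.
have pi0 : 0 < pi :> R by exact: pi_gt0.
have [p0 p1] : 0 < pi :> R /\ pi < 2 * pi :> R by lra.
have same_sg (a b : R) : 0 < a -> a < 2 * pi -> 0 < b -> b < 2 * pi ->
    a <= b -> Num.sg (phi^`()%classic a) = Num.sg (phi^`()%classic b).
  move=> a0 a1 b0 b1 ab; apply: contrapT => sab.
  have cp : {within `[a, b], continuous phi^`()}.
    apply: continuous_in_subspaceT => x /set_mem; rewrite /= in_itv/= => /andP[ax xb].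
    apply: smooth_at_continuous; apply: smooth_at_derive1; apply: sphi.
    by apply: period_dom; rewrite periodE; lra.
  have [|c] := @IVT R (phi^`()%classic) a b 0 ab cp.
    have := phi'_neq0 a0 a1; have := phi'_neq0 b0 b1; move: sab.
    rewrite ge_min le_max.
    case: (sgrP (phi^`()%classic a)) => // ha; case: (sgrP (phi^`()%classic b)) => // hb;
      by rewrite ?(ltW ha) ?(ltW hb) ?orbT.
  rewrite in_itv/= => /andP[ac cb] /eqP; apply/negP; apply: phi'_neq0; lra.
exists (Num.sg (phi^`()%classic pi)).
  have := phi'_neq0 p0 p1; case: (sgrP (phi^`()%classic pi)) => [|_ _|_ _].
  - by [].
  - by left.
  - by right.
move=> t t0 t1; rewrite [LHS]normrEsg; congr (_ * _).
by case: (leP t pi) => [h|/ltW h]; [|apply/esym]; exact: same_sg.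
Qed.

(** The change of variables [s = phi t], carried out on an antiderivative [F] of
the density of [c1]: up to the sign [e] of [phi'], the density of [c2] is the
derivative of [F o phi]. On the segment [phi] is monotone and onto, hence fixes or
exchanges the end points. On the circle it advances by [e * m] periods, where [m]
is positive by monotony and at most 1 because [phi] is injective modulo the
period. *)
Lemma varifold_reparam : varifold c1 omega = varifold c2 omega.
Proof.
have [e e1 sgE] := ex_sign.
have cd1 : continuous density1 by exact: density_continuous.
have cd2 : continuous density2 by exact: density_continuous.
have [F dF] := ex_antiderivative cd1.
have cF t : {for t, continuous F} by have [dFt _] := dF t; exact: derivable_continuous.
have pd (t : R) : period t -> dom M t by exact: period_dom.
have P0 : @period R 0 by rewrite periodE lexx ltW.
have P1 : @period R (2 * pi) by rewrite periodE lexx ltW.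
have cphi t : period t -> {for t, continuous phi}.
  by move=> pt; apply: smooth_at_continuous; apply: sphi; exact: pd.
have I1 : varifold c1 omega = F (2 * pi) - F 0.
  rewrite (varifoldE i1).
  exact: (integral_period_FTC cd1 (fun t _ => cF t) (fun t _ _ => dF t)).
have I2 : varifold c2 omega = e * (F (phi (2 * pi)) - F (phi 0)).
  rewrite (varifoldE i2) mulrBr.
  apply: (@integral_period_FTC _ _ (fun t => e * F (phi t))) => //.
    move=> t pt; apply: cvgM; first exact: cvg_cst.
    apply: (@cvg_comp _ _ _ phi F _ (nbhs (phi t))); [exact: cphi|exact: cF].
  move=> t t0 t1; rewrite -/(density2 t) (densityE t0 t1) (sgE t t0 t1) mulrCA.
  have dt : dom M t := nbhs_singleton (interior_dom t0 t1).
  have D : is_derive t 1 (F \o phi) (density1 (phi t) * phi^`()%classic t).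
    have Dp := derive1P (smooth_at_derivable (sphi dt)) erefl.
    exact: (is_derive1_comp (dF (phi t)) Dp).
  exact: (is_deriveZ e D).
have mono (s t : R) : period s -> period t -> s <= t -> e * phi s <= e * phi t.
  move=> ps pt st; apply: (@ger0_derive1_le_cc R (fun t => e * phi t) 0 (2 * pi)) => //.
  - move=> x; rewrite in_itv/= => /andP[x0 x1].
    have dx : dom M x := nbhs_singleton (interior_dom x0 x1).
    by apply: (@derivableZ _ _ _ phi e); exact: smooth_at_derivable (sphi dx).
  - move=> x; rewrite in_itv/= => /andP[x0 x1].
    have dx : dom M x := nbhs_singleton (interior_dom x0 x1).
    have -> : (fun t => e * phi t)^`()%classic x = e * phi^`()%classic x.
      apply: is_derive_derive1; apply: (@is_deriveZ _ _ _ phi e).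
      by apply: derive1P => //; exact: smooth_at_derivable (sphi dx).
    by rewrite -sgE// normr_ge0.
  - apply: continuous_in_subspaceT => x /set_mem xp.
    by apply: cvgM; [exact: cvg_cst|exact: cphi].
have ivt (y : R) : Num.min (phi 0) (phi (2 * pi)) <= y <= Num.max (phi 0) (phi (2 * pi)) ->
    exists2 t, period t & phi t = y.
  move=> yI; have cp : {within `[0, 2 * pi], continuous phi}.
    by apply: continuous_in_subspaceT => x /set_mem xp; exact: cphi.
  by have [t tI ty] := IVT (ltW tp) cp yI; exists t.
have [_ [psi [[_ dpsi spsi] psiK phiK]]] := phi_diffeo.
have [[_ _ sphi'] _] := phi_diffeo.
have D0 := pd _ P0; have D1 := pd _ P1.
have inj0 (t : R) : period t -> same M (phi 0) (phi t) -> same M 0 t.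
  move=> pt s0t; have dt := pd _ pt.
  have h := spsi _ _ (dphi D0) (dphi dt) s0t.
  exact: same_trans (same_sym (psiK _ D0)) (same_trans h (psiK _ dt)).
rewrite {}I1 {}I2; have [ME|ME] : M = Segment \/ M = Circle by case: (M); [right|left].
  have dseg t : dom M t -> 0 <= t <= 2 * pi by rewrite ME -periodE.
  have phiKseg t : dom M t -> phi (psi t) = t by move=> /phiK; rewrite ME.
  have [/dseg/andP[a0 a1] /dseg/andP[b0 b1]] := (dphi D0, dphi D1).
  have [p0 p1] : period (psi 0) /\ period (psi (2 * pi)).
    by rewrite !periodE; split; apply: dseg; exact: dpsi.
  have ends t : period t -> e * phi 0 <= e * phi t <= e * phi (2 * pi).
    move=> pt; move: (pt); rewrite periodE => /andP[t0 t1].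
    by rewrite !mono.
  have /andP[] := ends _ p0; have /andP[] := ends _ p1.
  rewrite !phiKseg//; case: e1 => ->; rewrite ?mul1r ?mulN1r => h1 h2 h3 h4.
    have -> : phi 0 = 0 by lra.
    by have -> : phi (2 * pi) = 2 * pi by lra.
  have -> : phi 0 = 2 * pi by lra.
  have -> : phi (2 * pi) = 0 by lra.
  by rewrite opprB.
have [k kE] : exists k : int, phi (2 * pi) = phi 0 + k%:~R * (2 * pi).
  have : same M (phi 0) (phi (2 * pi)).
    by apply: sphi' => //; rewrite ME; exists 1; rewrite add0r mul1r.
  by rewrite ME.
have ends t (j : int) : period t -> phi t = phi 0 + j%:~R * (2 * pi) ->
    t = 0 \/ t = 2 * pi.
  move=> pt tj; have := inj0 t pt; rewrite {1}ME => /(_ (ex_intro _ j tj)).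
  rewrite ME => -[i]; rewrite add0r => tE.
  move: pt; rewrite periodE tE pmulr_lge0// ger_pMl// ler0z => /andP[z0 z1].
  have {}z1 : i <= 1 by rewrite -(ler_int R).
  case: i z0 z1 tE => // -[|[|n]] //= _ _ _; first by left; rewrite mul0r.
  by right; rewrite mul1r.
have [j jE] : exists j : int, e = j%:~R.
  by case: e1 => ->; [exists 1|exists (-1)].
have ee : e * e = 1 by case: e1 => ->; rewrite ?mulrNN mulr1.
have kE' : k%:~R = e * (j * k)%:~R by rewrite intrM -jE mulrA ee mul1r.
have pi0 : 0 < pi :> R by exact: pi_gt0.
(* m is the product j * k, where j is the sign e as an integer *)
have m1 : j * k = 1.
  have m0 : 0 <= j * k.
    have := mono 0 (2 * pi) P0 P1 (ltW tp).
    rewrite kE mulrDr lerDl.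
    have -> : e * (k%:~R * (2 * pi)) = (e * e) * (j * k)%:~R * (2 * pi).
      by rewrite kE'; ring.
    by rewrite ee mul1r pmulr_lge0// ler0z.
  have mn0 : j * k <> 0.
    move=> m0'; move: kE; rewrite kE' m0' mulr0 mul0r addr0 => k0.
    have Pp : @period R pi by rewrite periodE; lra.
    have := mono 0 pi P0 Pp (ltW pi0); have := mono pi (2 * pi) Pp P1.
    rewrite k0 => h1 h2.
    have h3 : e * phi pi = e * phi 0.
      by apply/eqP; rewrite eq_le h2 h1//; lra.
    have h4 : phi pi = phi 0.
      by rewrite -[LHS]mul1r -ee -mulrA h3 mulrA ee mul1r.
    by case: (@ends pi 0 Pp) => [|h|h]; [rewrite h4 mul0r addr0|lra|lra].
  (* otherwise [phi 0 + e * (2 * pi)] is attained strictly inside the period *)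
  have m2 : ~ 2 <= j * k.
    move=> m2; have {}m2 : 2 <= (j * k)%:~R :> R by rewrite (ler_int R 2).
    have [|t pt ty] := ivt (phi 0 + e * (2 * pi)).
      rewrite ge_min le_max kE kE'; case: e1 => ->; rewrite ?mul1r ?mulN1r.
        by apply/andP; split; apply/orP; [left|right]; nra.
      by apply/andP; split; apply/orP; [right|left]; nra.
    have [|t0|t1] := @ends t j pt; first by rewrite ty jE.
      move: ty; rewrite t0; case: e1 => ->; lra.
    move: ty; rewrite t1 kE kE'; case: e1 => ->; nra.
  move: m0 mn0 m2; lia.
have phiE : phi (2 * pi) = phi 0 + e * (2 * pi) by rewrite kE kE' m1 mulr1.
have per1 (t : R) : density1 (t + 2 * pi) = density1 t.
  have st : same M t (t + 2 * pi) by rewrite ME; exists 1; rewrite mul1r.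
  have dt (u : R) : dom M u by rewrite ME.
  have cE := imm_same i1 (dt t) (dt _) st.
  have c'E := imm_derive_same i1 (dt t) (dt _) st.
  have dirE : set_val (tangent_dir i1 (t + 2 * pi)) = set_val (tangent_dir i1 t).
    by rewrite !tangent_dirE (clampE (dt t)) (clampE (dt (t + 2 * pi))) c'E.
  have spE : speed M c1 (t + 2 * pi) = speed M c1 t.
    by rewrite /speed (clampE (dt t)) (clampE (dt (t + 2 * pi))) c'E.
  have lE : lift i1 (t + 2 * pi) = lift i1 t.
    by rewrite /lift (clampE (dt t)) (clampE (dt (t + 2 * pi))) cE (val_inj dirE).
  by rewrite /density1 lE spE.
have Fper (x : R) : F (x + 2 * pi) - F x = F (2 * pi) - F 0.
  rewrite -{2}[2 * pi]add0r.
  apply: (@is_derive_0_segment _ (fun x => F (x + 2 * pi) - F x)) => z _.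
  have D : is_derive z 1 (fun y : R => y + 2 * pi) 1.
    by rewrite -[X in is_derive _ _ _ X]addr0; apply: is_deriveD.
  have DF := @is_derive1_comp R F (fun y : R => y + 2 * pi) z _ _ (dF (z + 2 * pi)) D.
  rewrite per1 mulr1 in DF.
  by rewrite -(subrr (density1 z)); exact: (is_deriveB DF (dF z)).
rewrite phiE; case: e1 => ->; rewrite ?mul1r ?mulN1r ?Fper//.
by rewrite opprB -[in F (phi 0)](subrK (2 * pi) (phi 0)) Fper.
Qed.

End Invariance.

(** * The varifold distance *)

Section Distance.
Variables (R : realType) (d : nat) (rho gamma : R -> R).
Local Notation k := (@varifold_kernel R d rho gamma).
Variable H : rkhs k.
Hypothesis H_embedded : embedded_C0 H.

(** The kernel functions at two opposite directions coincide, and the values of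
[f] are its products with the kernel functions. *)
Lemma rkhs_even :
  (forall t, -1 <= t <= 1 -> gamma (- t) = gamma t) ->
  forall f, rkhs_set H f -> forall x u v, set_val u = - set_val v ->
    f (x, u) = f (x, v).
Proof.
move=> gamma_even f Hf x u v uv.
rewrite -(rkhs_reproducing (r := H) (x, u) Hf) -(rkhs_reproducing (r := H) (x, v) Hf).
congr rkhs_dot; apply/funext => -[y w].
rewrite /varifold_kernel /zonal_kernel /=; congr (_ * _).
rewrite uv -scaleN1r dotvZl mulN1r.
by apply: gamma_even; exact: dotv_sphere_itv.
Qed.

Lemma rkhs_continuous f : rkhs_set H f -> continuous f.
Proof. by move=> /H_embedded.1[]. Qed.

(** The embedding into the continuous functions bounds the difference of the two
varifolds on the unit ball, so that its dual norm is an actual supremum. *)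
Lemma dVar_eq0 M c1 c2 : immersion M c1 -> immersion M c2 ->
  dVar H c1 c2 = 0 <->
  forall f, rkhs_set H f -> varifold c1 f = varifold c2 f.
Proof.
move=> i1 i2; pose l f := varifold c1 f - varifold c2 f.
rewrite /dVar /dual_norm; set B := [set _ | _ in _].
have c1C : continuous (fun _ : pos_dir R d => 1 : R) by move=> p; exact: cvg_cst.
have c0C : continuous (fun _ : pos_dir R d => 0 : R) by move=> p; exact: cvg_cst.
have V0 (c : R -> 'rV[R]_d) (i : immersion M c) : varifold c (fun=> 0) = 0.
  by apply: (varifold_eq0 (c_imm := i)).
have lZ (a : R) (f : pos_dir R d -> R) : continuous f -> l (fun p => a * f p) = a * l f.
  have E c (i : immersion M c) : continuous f ->
      varifold c (fun p => a * f p) = a * varifold c f.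
    move=> cf; have -> : (fun p => a * f p) = (fun p => a * f p + (fun=> 0) p).
      by apply/funext => p; rewrite addr0.
    apply: etrans (varifold_linear i a cf c0C) _.
    by apply: etrans (congr1 (+%R _) (V0 c i)) _; exact: addr0.
  by move=> cf; rewrite /l (E _ i1 cf) (E _ i2 cf) mulrBr.
have [_ [C HC]] := H_embedded.
have B0 : B 0.
  exists (fun=> 0); last by rewrite (V0 _ i1) (V0 _ i2) subrr normr0.
  split; first exact: rkhs0.
  by rewrite /rkhs_norm /form_norm rkhs_dot0l ?sqrtr0//; exact: rkhs0.
have ubB : has_ubound B.
  exists (`|C| * (varifold c1 (fun=> 1 : R) + varifold c2 (fun=> 1 : R))) => _ [f [Hf Nf] <-].
  have fC p : `|f p| <= `|C| * 1.
    apply: le_trans (HC f p Hf) _; apply: le_trans (ler_norm _) _.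
    by rewrite normrM ler_wpM2l// ger0_norm// rkhs_norm_ge0.
  have cf := rkhs_continuous Hf.
  apply: le_trans (ler_normB _ _) _; rewrite mulrDr; apply: lerD.
    exact: (varifold_bound i1 cf c1C fC).
  exact: (varifold_bound i2 cf c1C fC).
split=> [B00 f Hf|eqV].
  have N0 : 0 <= rkhs_norm H f := rkhs_norm_ge0 H f.
  have [a a0 aN] : exists2 a : R, 0 < a & a * rkhs_norm H f <= 1.
    move: (rkhs_norm H f) N0 => n n0; exists (1 + n)^-1.
      by rewrite invr_gt0 ltr_pwDl.
    by rewrite mulrC ler_pdivrMr ?ltr_pwDl// mul1r lerDr.
  have Bf : B `|l (fun p => a * f p)|.
    exists (fun p => a * f p); last by [].
    split; first exact: rkhsZ.
    by rewrite /= (rkhs_normZ a Hf) (gtr0_norm a0).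
  have := ub_le_sup ubB Bf; rewrite B00 (lZ a f (rkhs_continuous Hf)).
  rewrite normr_le0 mulf_eq0 (gt_eqF a0) /= subr_eq0 => /eqP.
  by apply.
have -> : B = [set 0].
  apply/seteqP; split => [_ [f [Hf _] <-]|_ ->]; last exact: B0.
  by rewrite (eqV f Hf) subrr normr0.
exact: sup1.
Qed.

End Distance.

Theorem corollary3p7 (R : realType) (d : nat) (hd : (2 <= d)%N)
    (M : manifold1) (rho gamma : R -> R)
    (rho_cont : {within `[0, +oo[, continuous rho})
    (rho_pd : positive_definite (@radial_kernel R d rho))
    (rho_infty : rho t @[t --> +oo] --> 0)
    (gamma_cont : {within `[-1, 1], continuous gamma})
    (gamma_pd : positive_definite (@zonal_kernel R d gamma))
    (k_pd : positive_definite (@varifold_kernel R d rho gamma))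
    (H : rkhs (@varifold_kernel R d rho gamma))
    (H_embedded : embedded_C0 H)
    (rho_C1 : C1_on `[0, +oo[ rho)
    (gamma_C1 : C1_on `[-1, 1] gamma)
    (rho_universal : C0_universal (@radial_kernel R d rho))
    (gamma1_gt0 : 0 < gamma 1)
    (gamma_even : forall t, -1 <= t <= 1 -> gamma (- t) = gamma t)
    (c1 c2 : R -> 'rV[R]_d)
    (c1_imm : immersion M c1) (c2_imm : immersion M c2)
    (c1_transverse : finite_transverse_self_intersections M c1)
    (c2_transverse : finite_transverse_self_intersections M c2) :
  equal_in_Bi M c1 c2 <-> dVar H c1 c2 = 0.
Proof.
  split=> [[phi dphi c2E]|].
    apply/(dVar_eq0 H_embedded c1_imm c2_imm) => f Hf.
    apply: (varifold_reparam c1_imm c2_imm dphi c2E).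
      exact: (rkhs_continuous H_embedded Hf).
    exact: (rkhs_even gamma_even Hf).
  move=> /(dVar_eq0 H_embedded c1_imm c2_imm) eqV.
  have V12 f v : C0 f ->
      varifold c1 (tensor gamma f v) = varifold c2 (tensor gamma f v).
    apply: (varifold_tensor_eq gamma_C1 c1_imm c2_imm rho_universal) => q.
    by apply: eqV; exact: rkhs_kernel.
  have V21 f v : C0 f ->
      varifold c2 (tensor gamma f v) = varifold c1 (tensor gamma f v).
    by move=> Cf; exact: esym (V12 f v Cf).
  apply: (equal_images_equal_in_Bi c1_imm c2_imm c1_transverse c2_transverse).
    exact: (image_subset gamma_C1 gamma1_gt0 c2_imm c1_imm V21 c2_transverse.1).
  exact: (image_subset gamma_C1 gamma1_gt0 c1_imm c2_imm V12 c1_transverse.1).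
Qed.
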